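(* Let $\mathsf{K}\in\mathcal{C}_{\mathrm{nd}}$ be any non-degenerate policy for $\mathcal{H}_\infty$ control. If $\mathsf{K}$ is a Clarke stationary point, i.e., $0\in\partial J_{\infty,n}(\mathsf{K})$, then it is a global minimizer of $J_{\infty,n}$ over $\mathcal{C}_n$.
   Context: Plant data: integers $n,m,p\ge 1$, real matrices $A\in\mathbb{R}^{n\times n}$, $B\in\mathbb{R}^{n\times m}$, $C\in\mathbb{R}^{p\times n}$, and symmetric weights $Q\succeq 0$, $W\succeq 0$ ($n\times n$), $R\succ 0$ ($m\times m$), $V\succ 0$ ($p\times p$); $M^{1/2}$ is the symmetric positive semidefinite square root. Standing assumptions: $(A,B)$ and $(A,W^{1/2})$ are controllable, $(C,A)$ and $(Q^{1/2},A)$ are observable. A square matrix is stable if all its eigenvalues have strictly negative real parts. A dynamic policy of order $n$ is a matrix $\mathsf{K}=\begin{bmatrix}D_{\mathsf K} & C_{\mathsf K}\\ B_{\mathsf K} & A_{\mathsf K}\end{bmatrix}\in\mathbb{R}^{(m+n)\times(p+n)}$ with $A_{\mathsf K}\in\mathbb{R}^{n\times n}$, $B_{\mathsf K}\in\mathbb{R}^{n\times p}$, $C_{\mathsf K}\in\mathbb{R}^{m\times n}$, $D_{\mathsf K}\in\mathbb{R}^{m\times p}$. Define $$A_{\mathrm{cl}}(\mathsf K)=\begin{bmatrix}A+BD_{\mathsf K}C & BC_{\mathsf K}\\ B_{\mathsf K}C & A_{\mathsf K}\end{bmatrix},\quad B_{\mathrm{cl}}(\mathsf K)=\begin{bmatrix}W^{1/2}&BD_{\mathsf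 K}V^{1/2}\\ 0&B_{\mathsf K}V^{1/2}\end{bmatrix},$$ $$C_{\mathrm{cl}}(\mathsf K)=\begin{bmatrix}Q^{1/2}&0\\ R^{1/2}D_{\mathsf K}C&R^{1/2}C_{\mathsf K}\end{bmatrix},\quad D_{\mathrm{cl}}(\mathsf K)=\begin{bmatrix}0&0\\ 0&R^{1/2}D_{\mathsf K}V^{1/2}\end{bmatrix}.$$ $\mathcal{C}_n=\{\mathsf K\in\mathbb{R}^{(m+n)\times(p+n)}: A_{\mathrm{cl}}(\mathsf K)\text{ is stable}\}$, an open set. The $\mathcal{H}_\infty$ cost is $J_{\infty,n}(\mathsf K)=\sup_{\omega\in\mathbb{R}}\sigma_{\max}\big(C_{\mathrm{cl}}(\mathsf K)(j\omega I-A_{\mathrm{cl}}(\mathsf K))^{-1}B_{\mathrm{cl}}(\mathsf K)+D_{\mathrm{cl}}(\mathsf K)\big)$ for $\mathsf K\in\mathcal{C}_n$, with $\sigma_{\max}$ the largest singular value. This function is locally Lipschitz on $\mathcal{C}_n$. For a locally Lipschitz $f$ on an open subset of a Euclidean space (here matrices with the trace inner product), the Clarke directional derivative is $f^\circ(x;v)=\limsup_{x'\to x,\,t\downarrow0}\frac{f(x'+tv)-f(x')}{t}$ and the Clarke subdifferential is $\partial f(x)=\{g: f^\circ(x;v)\ge\langle g,v\rangle\ \forall v\}$. $\mathcal{C}_{\mathrm{nd}}$ (the non-degenerate policies for $\mathcal{H}_\infty$ control) is the set of $\mathsf K\in\mathcal{C}_n$ such that, with $\gamma=J_{\infty,n}(\mathsf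 K)$, there exists a symmetric positive definite $P=\begin{bmatrix}P_{11}&P_{12}\\ P_{12}^{\mathsf T}&P_{22}\end{bmatrix}\in\mathbb{R}^{2n\times2n}$ (with $n\times n$ blocks) whose block $P_{12}$ is invertible and such that $$\begin{bmatrix}A_{\mathrm{cl}}(\mathsf K)^{\mathsf T}P+PA_{\mathrm{cl}}(\mathsf K)&PB_{\mathrm{cl}}(\mathsf K)&C_{\mathrm{cl}}(\mathsf K)^{\mathsf T}\\ B_{\mathrm{cl}}(\mathsf K)^{\mathsf T}P&-\gamma I&D_{\mathrm{cl}}(\mathsf K)^{\mathsf T}\\ C_{\mathrm{cl}}(\mathsf K)&D_{\mathrm{cl}}(\mathsf K)&-\gamma I\end{bmatrix}\preceq0.$$ *)

(* Defs.v *)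
From HB Require Import structures.
From mathcomp Require Import all_boot all_order all_algebra.
From mathcomp Require Import spectral.
From mathcomp Require Export complex.
From mathcomp Require Export all_classical all_reals all_analysis.

Set Implicit Arguments.
Unset Strict Implicit.
Unset Printing Implicit Defensive.

Import Order.TTheory GRing.Theory Num.Theory.
Import numFieldNormedType.Exports.

Local Open Scope classical_set_scope.
Local Open Scope ring_scope.
Local Open Scope sesquilinear_scope.

Section Matrices.
Variable R : realType.

Definition psdmx n (M : 'M[R]_n) : Prop :=
  M \is symmetricmx /\ forall x : 'cV[R]_n, 0 <= (x^T *m M *m x) 0 0.

Definition pdmx n (M : 'M[R]_n) : Prop :=
  M \is symmetricmx /\
  forall x : 'cV[R]_n, x != 0 -> 0 < (x^T *m M *m x) 0 0.

Definition nsdmx n (M : 'M[R]_n) : Prop := psdmx (- M).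

(* Meaningful when M is positive semidefinite: the root then exists and is
   unique. *)
Definition sqrtmx n (M : 'M[R]_n) : 'M[R]_n :=
  xget 0 [set S : 'M[R]_n | psdmx S /\ S *m S = M].

Definition complexmx m n (M : 'M[R]_(m, n)) : 'M[R[i]]_(m, n) :=
  map_mx (real_complex R) M.

Definition hurwitzmx n (M : 'M[R]_n) : Prop :=
  forall l : R[i], eigenvalue (complexmx M) l -> complex.Re l < 0.

Definition controllable n m (A : 'M[R]_n) (B : 'M[R]_(n, m)) : Prop :=
  \rank (\mxrow_(i < n) (A ^+ i *m B)) = n.

Definition observable n p (C : 'M[R]_(p, n)) (A : 'M[R]_n) : Prop :=
  \rank (\mxcol_(i < n) (C *m A ^+ i)) = n.

Definition singular_value m n (M : 'M[R[i]]_(m, n)) (s : R) : Prop :=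
  0 <= s /\ eigenvalue (M ^t* *m M) (real_complex R (s ^+ 2)).

(* The supremum of a finite set, nonempty as soon as n > 0. *)
Definition sigma_max m n (M : 'M[R[i]]_(m, n)) : R :=
  sup [set s | singular_value M s].

(* limsup over the pairs (y, t) with y -> x and t -> 0, t > 0 *)
Definition clarke_dd m n (f : 'M[R]_(m, n) -> R) (x v : 'M[R]_(m, n)) : \bar R :=
  limf_esup (fun yt : 'M[R]_(m, n) * R =>
               ((f (yt.1 + yt.2 *: v) - f yt.1) / yt.2)%:E)
            (filter_prod (nbhs x) (at_right (0 : R))).

Definition clarke_subdiff m n (f : 'M[R]_(m, n) -> R) (x : 'M[R]_(m, n)) :
    set 'M[R]_(m, n) :=
  [set g | forall v, ((\tr (g^T *m v))%:E <= clarke_dd f x v)%E].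

End Matrices.

Record plant (R : realType) (n m p : nat) := Plant {
  pA : 'M[R]_n;
  pB : 'M[R]_(n, m);
  pC : 'M[R]_(p, n);
  pQ : 'M[R]_n;
  pW : 'M[R]_n;
  pR : 'M[R]_m;
  pV : 'M[R]_p }.

Section ClosedLoop.
Variables (R : realType) (n m p : nat) (G : plant R n m p).

(* K = [D_K, C_K; B_K, A_K] *)
Implicit Type K : 'M[R]_(m + n, p + n).

Definition DK K : 'M[R]_(m, p) := ulsubmx K.
Definition CK K : 'M[R]_(m, n) := ursubmx K.
Definition BK K : 'M[R]_(n, p) := dlsubmx K.
Definition AK K : 'M[R]_n := drsubmx K.

Definition Acl K : 'M[R]_(n + n) :=
  block_mx (pA G + pB G *m DK K *m pC G) (pB G *m CK K)
           (BK K *m pC G)                (AK K).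

Definition Bcl K : 'M[R]_(n + n, n + p) :=
  block_mx (sqrtmx (pW G)) (pB G *m DK K *m sqrtmx (pV G))
           0               (BK K *m sqrtmx (pV G)).

Definition Ccl K : 'M[R]_(n + m, n + n) :=
  block_mx (sqrtmx (pQ G))                  0
           (sqrtmx (pR G) *m DK K *m pC G)  (sqrtmx (pR G) *m CK K).

Definition Dcl K : 'M[R]_(n + m, n + p) :=
  block_mx 0 0
           0 (sqrtmx (pR G) *m DK K *m sqrtmx (pV G)).

Definition stabilizing : set 'M[R]_(m + n, p + n) :=
  [set K | hurwitzmx (Acl K)].

Definition transfer K (w : R) : 'M[R[i]]_(n + m, n + p) :=
  complexmx (Ccl K) *m invmx ((Complex 0 w)%:M - complexmx (Acl K))
    *m complexmx (Bcl K) + complexmx (Dcl K).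

(* Only meaningful for stabilizing K, where the supremum is finite. *)
Definition Hinf_cost K : R :=
  sup (range (fun w : R => sigma_max (transfer K w))).

Definition brl_mx (gamma : R) K (P : 'M[R]_(n + n)) :
    'M[R]_((n + n) + (n + p) + (n + m)) :=
  block_mx
    (block_mx ((Acl K)^T *m P + P *m Acl K) (P *m Bcl K)
              ((Bcl K)^T *m P)              (- gamma%:M))
    (col_mx (Ccl K)^T (Dcl K)^T)
    (row_mx (Ccl K) (Dcl K))
    (- gamma%:M).

Definition nondegenerate_policy : set 'M[R]_(m + n, p + n) :=
  [set K | stabilizing K /\
    exists P : 'M[R]_(n + n),
      [/\ pdmx P, ursubmx P \in unitmx & nsdmx (brl_mx (Hinf_cost K) K P)]].

End ClosedLoop.

(* Main.v *)
Require Import Defs.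
From mathcomp Require Import all_boot all_order all_algebra.
From mathcomp Require Import spectral.
From mathcomp Require Import all_classical all_reals all_analysis.
From mathcomp Require Import ring lra.

(** Write J for the cost and g = J(K), which may be assumed positive. The largest
    singular value of the transfer matrix T(K, jw) is the maximum of
    Re (z^* T(K, jw) v) over v, z in the unit balls, so J is a supremum of
    functions that are smooth in K. Writing w = s/c
    with (c, s) on the unit circle, c = 0 being the infinite frequency, makes the
    set of tests (c, s, v, z) compact.

    Stationarity gives multipliers. If every test that attains g decreased along
    a direction, then by compactness J would decrease at a uniform rate near K
    and its Clarke derivative would be negative (clarke_active). So the gradients
    at active tests have no common descent direction, and by Gordan's alternative
    a convex combination of finitely many of them vanishes (gordan,
    clarke_certificate).

    The matrix inequality identifies the active tests. Along a closed-loop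
    solution x its storage term drops out, so an active test is a zero of a
    semidefinite form and lies in the kernel (brl_kernel). Hence P x is the
    costate, and the disturbance is a function of P x and z.

    The multipliers force optimality. Split x into plant state xi and controller
    state eta, and P x into p and zeta. The vanishing combination says that
    a = B^T p + R'^T z2, with R' the square root of R, and zeta are orthogonal
    to the measurement y and to eta, where signals are paired by the sum over the
    tests of Re (x_i y_i^* ). Because P12 is invertible, zeta amounts to the
    error e = xi + P12^-T P22 eta. The orthogonality relations then give, each
    time by exhibiting a signal orthogonal to itself: a is a function of e; y is
    a function of eta; the disturbance at infinite frequency is 0; and e runs
    autonomously, jw e = F e. Feed the same disturbances to a stabilizing K'
    with closed-loop matrix A'. The difference d of the closed-loop states is
    driven by eta, so M, the sum of Re (e_i d_i^* ), satisfies F M = - M A'^T.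
    The modes e lie on the imaginary axis and A' is stable, so M = 0
    (sylvester_cov_eq0). By the adjoint equation the pairing of z with the output
    changes by pairings of e with d and eta, which are 0 (pairing_invariant). So
    K' achieves g on these tests, and J(K') >= g (certificate_optimal). *)

Set Implicit Arguments.
Unset Strict Implicit.
Unset Printing Implicit Defensive.
Import Order.TTheory GRing.Theory Num.Theory.
Import numFieldNormedType.Exports.
Local Open Scope classical_set_scope.
Local Open Scope ring_scope.

(** * Limits of matrices *)

Section MatrixConvergence.
Context (R : realType) (T : Type) (F : set_system T) {FF : Filter F}.

Lemma cvg_mx m n (f : T -> 'M[R]_(m, n)) (L : 'M[R]_(m, n)) :
  (forall i j, f t i j @[t --> F] --> L i j) <-> f @ F --> L.
Proof.
split=> [fL A [P LP PA]|fL i j]; last first.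
  exact: (cvg_comp _ _ fL (@coord_continuous R m n i j L)).
have : \forall t \near F, forall i j, P i j (f t i j).
  apply: filter_forall => i; apply: filter_forall => j.
  exact: (fL i j _ (LP i j)).
by apply: filterS => t Pt; apply: PA.
Qed.

Lemma cvg_addmx m n (f g : T -> 'M[R]_(m, n)) (a b : 'M[R]_(m, n)) :
  f @ F --> a -> g @ F --> b -> f t + g t @[t --> F] --> a + b.
Proof.
move=> /cvg_mx fa /cvg_mx gb; apply/cvg_mx => i j; rewrite mxE.
under eq_fun do rewrite mxE.
exact: cvgD.
Qed.

Lemma cvg_oppmx m n (f : T -> 'M[R]_(m, n)) (a : 'M[R]_(m, n)) :
  f @ F --> a -> - f t @[t --> F] --> - a.
Proof.
move=> /cvg_mx fa; apply/cvg_mx => i j; rewrite mxE.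
under eq_fun do rewrite mxE.
exact: cvgN.
Qed.

Lemma cvg_scalemx m n (c : T -> R) (f : T -> 'M[R]_(m, n)) (k : R)
    (a : 'M[R]_(m, n)) :
  c @ F --> k -> f @ F --> a -> c t *: f t @[t --> F] --> k *: a.
Proof.
move=> ck /cvg_mx fa; apply/cvg_mx => i j; rewrite mxE.
under eq_fun do rewrite mxE.
exact: cvgM.
Qed.

Lemma cvg_trmx m n (f : T -> 'M[R]_(m, n)) (a : 'M[R]_(m, n)) :
  f @ F --> a -> (f t)^T @[t --> F] --> a^T.
Proof.
move=> /cvg_mx fa; apply/cvg_mx => i j; rewrite mxE.
under eq_fun do rewrite mxE.
exact: fa.
Qed.

Lemma cvg_sumr (I : Type) (r : seq I) (P : pred I) (f : I -> T -> R)
    (a : I -> R) :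
  (forall i, f i @ F --> a i) ->
  \sum_(i <- r | P i) f i t @[t --> F] --> \sum_(i <- r | P i) a i.
Proof.
by move=> fa; apply: (@cvg_big _ _ _ _ _ (@add_continuous R)) => // i _; exact: fa.
Qed.

Lemma cvg_prodr (I : Type) (r : seq I) (P : pred I) (f : I -> T -> R)
    (a : I -> R) :
  (forall i, f i @ F --> a i) ->
  \prod_(i <- r | P i) f i t @[t --> F] --> \prod_(i <- r | P i) a i.
Proof.
by move=> fa; apply: (@cvg_big _ _ _ _ _ (@mul_continuous R)) => // i _; exact: fa.
Qed.

Lemma cvg_mulmx m n p (f : T -> 'M[R]_(m, n)) (g : T -> 'M[R]_(n, p))
    (a : 'M[R]_(m, n)) (b : 'M[R]_(n, p)) :
  f @ F --> a -> g @ F --> b -> f t *m g t @[t --> F] --> a *m b.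
Proof.
move=> /cvg_mx fa /cvg_mx gb; apply/cvg_mx => i j; rewrite mxE.
under eq_fun do rewrite mxE.
by apply: cvg_sumr => k; apply: cvgM.
Qed.

Lemma cvg_mxtrace n (f : T -> 'M[R]_n) (a : 'M[R]_n) :
  f @ F --> a -> \tr (f t) @[t --> F] --> \tr a.
Proof. by move=> /cvg_mx fa; apply: cvg_sumr => i; exact: fa. Qed.

Lemma cvg_det n (f : T -> 'M[R]_n) (a : 'M[R]_n) :
  f @ F --> a -> \det (f t) @[t --> F] --> \det a.
Proof.
move=> /cvg_mx fa; apply: cvg_sumr => s; apply: cvgM; first exact: cvg_cst.
by apply: cvg_prodr => i.
Qed.

Lemma cvg_invmx n (f : T -> 'M[R]_n) (a : 'M[R]_n) :
  a \in unitmx -> f @ F --> a -> invmx (f t) @[t --> F] --> invmx a.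
Proof.
move=> aU fa.
have da : \det a != 0 by rewrite -unitfE -unitmxE.
have fU : \forall t \near F, \det (f t) != 0.
  exact: (cvg_det fa (open_nbhs_nbhs (conj (@open_neq R 0) da))).
suff : (\det (f t))^-1 *: \adj (f t) @[t --> F] --> invmx a.
  apply: cvg_trans; apply: near_eq_cvg; apply: filterS fU => t dt.
  by rewrite /invmx unitmxE unitfE dt.
rewrite /invmx aU; apply: cvg_scalemx; first by apply: cvgV => //; exact: cvg_det.
apply/cvg_mx => i j; rewrite mxE; under eq_fun do rewrite mxE.
apply: cvgM; first exact: cvg_cst.
apply: cvg_det; apply/cvg_mx => k l; rewrite !mxE; under eq_fun do rewrite !mxE.
by move/cvg_mx : fa; exact.
Qed.

End MatrixConvergence.

(** * Compactness and Gordan's alternative *)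

Lemma compact_setI_closed_in (X : topologicalType) (A B : set X) :
  compact A -> (forall x, A x -> ~ B x -> \forall y \near x, ~ B y) ->
  compact (A `&` B).
Proof.
move=> cA nB F PF FAB.
have FA : F A by apply: filterS FAB => x [].
have [x [Ax clx]] := cA F PF FA; exists x; split => //; split => //.
apply: contrapT => nBx; have := clx _ _ FAB (nB x Ax nBx).
by case=> y [[_ By]].
Qed.

(** Flattening matrices to row vectors reduces this to Tychonoff's theorem. *)
Lemma compact_mx_box (R : realType) m n (A : set R) :
  compact A -> compact [set M : 'M[R]_(m, n) | forall i j, A (M i j)].
Proof.
move=> cA.
have cV : compact [set v : 'rV[R]_(m * n) | forall i, A (v ord0 i)].
  exact: (rV_compact (fun=> cA)).
have -> : [set M : 'M[R]_(m, n) | forall i j, A (M i j)] =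
    vec_mx @` [set v : 'rV[R]_(m * n) | forall i, A (v ord0 i)].
  apply/seteqP; split=> [M MA|_ [v vA <-] i j]; last by rewrite mxE.
  exists (mxvec M); last exact: mxvecK.
  by move=> k; case/mxvec_indexP: k => i j; rewrite mxvecE.
apply: continuous_compact cV; apply: continuous_subspaceT => v.
apply: (iffLR (@cvg_mx _ _ _ (nbhs_filter v) _ _ _ _)) => i j.
rewrite mxE; under eq_fun do rewrite mxE.
exact: coord_continuous.
Qed.

Definition rdot (R : realType) d (x y : 'rV[R]_d) : R := \sum_i x 0 i * y 0 i.

Section DotProduct.
Variables (R : realType) (d : nat).
Implicit Types x y z : 'rV[R]_d.

Lemma rdotC x y : rdot x y = rdot y x.
Proof. by apply: eq_bigr => i _; rewrite mulrC. Qed.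

Lemma rdotDl x y z : rdot (x + y) z = rdot x z + rdot y z.
Proof. by rewrite -big_split; apply: eq_bigr => i _; rewrite mxE mulrDl. Qed.

Lemma rdotZl a x y : rdot (a *: x) y = a * rdot x y.
Proof. by rewrite mulr_sumr; apply: eq_bigr => i _; rewrite mxE mulrA. Qed.

Lemma rdotNl x y : rdot (- x) y = - rdot x y.
Proof. by rewrite -scaleN1r rdotZl mulN1r. Qed.

Lemma rdot_suml (I : finType) (f : I -> 'rV[R]_d) y :
  rdot (\sum_i f i) y = \sum_i rdot (f i) y.
Proof.
rewrite (big_morph (fun x => rdot x y) (fun a b => rdotDl a b y) (_ : rdot 0 y = 0)) //.
by rewrite /rdot big1 // => i _; rewrite mxE mul0r.
Qed.

Lemma rdot_ge0 x : 0 <= rdot x x.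
Proof. by apply: sumr_ge0 => i _; rewrite -expr2 sqr_ge0. Qed.

Lemma rdot_eq0 x : rdot x x = 0 -> x = 0.
Proof.
move=> /eqP; rewrite psumr_eq0 => [/allP x0|i _]; last by rewrite -expr2 sqr_ge0.
apply/rowP => i; rewrite mxE; have := x0 i (mem_index_enum i).
by rewrite -expr2 sqrf_eq0 => /eqP.
Qed.

(** The first-order condition of the projection onto a convex set: c is no longer
    than any point of the segment from c to x, so x lies beyond the hyperplane
    through c normal to c. *)
Lemma rdot_min_dir (c x : 'rV[R]_d) :
  (forall e, 0 <= e -> e <= 1 ->
     rdot c c <= rdot ((1 - e) *: c + e *: x) ((1 - e) *: c + e *: x)) ->
  rdot c c <= rdot x c.
Proof.
move=> hmin; rewrite leNgt; apply/negP => lt.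
have exp e : rdot ((1 - e) *: c + e *: x) ((1 - e) *: c + e *: x) =
    (1 - e) ^+ 2 * rdot c c + 2 * e * (1 - e) * rdot x c + e ^+ 2 * rdot x x.
  rewrite rdotDl !rdotZl !(rdotC _ ((1 - e) *: c + e *: x)) !rdotDl !rdotZl.
  by rewrite (rdotC c x); ring.
have q0 : 0 <= rdot c c - 2 * rdot x c + rdot x x.
  have := rdot_ge0 (c - x); rewrite rdotDl rdotNl !(rdotC _ (c - x)) !rdotDl.
  by rewrite !rdotNl (rdotC c x); lra.
set q := rdot c c - 2 * rdot x c + rdot x x in q0.
set b := rdot c c - rdot x c.
have b0 : 0 < b by rewrite /b subr_gt0.
have q1 : 0 < q + b by lra.
have e0 : 0 < b / (q + b) by rewrite divr_gt0.
have e1 : b / (q + b) <= 1 by rewrite ler_pdivrMr //; lra.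
have := hmin _ (ltW e0) e1; rewrite exp.
have -> : forall e, (1 - e) ^+ 2 * rdot c c + 2 * e * (1 - e) * rdot x c +
   e ^+ 2 * rdot x x = rdot c c + e * (e * q - 2 * b).
  by move=> e; rewrite /q /b; ring.
rewrite lerDl pmulr_rge0 // leNgt => /negP; apply.
rewrite subr_lt0; apply: (@le_lt_trans _ _ (b / (q + b) * (q + b))).
  by rewrite ler_wpM2l ?ltW //; lra.
by rewrite divfK ?gt_eqF //; lra.
Qed.

End DotProduct.

Section ConvexHull.
Variables (R : realType) (d : nat).
Implicit Types (y : 'I_d.+1 -> 'rV[R]_d) (l : 'I_d.+1 -> R).

Definition weights l := (forall i, 0 <= l i) /\ \sum_i l i = 1.

Definition comb l y : 'rV[R]_d := \sum_i l i *: y i.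

Lemma rdot_comb l y c : rdot (comb l y) c = \sum_i l i * rdot (y i) c.
Proof. by rewrite rdot_suml; apply: eq_bigr => i _; rewrite rdotZl. Qed.

Lemma weights_move l i e : weights l -> 0 <= e -> e <= 1 ->
  weights (fun k => (1 - e) * l k + e * (k == i)%:R).
Proof.
move=> [l0 l1] e0 e1; split=> [k|].
  by rewrite addr_ge0 // mulr_ge0 // ?subr_ge0 // ler0n.
rewrite big_split /= -!mulr_sumr l1 (bigD1 i) //= eqxx big1 ?addr0.
  by rewrite !mulr1 subrK.
by move=> k /negbTE ->.
Qed.

Lemma comb_move l y i e :
  comb (fun k => (1 - e) * l k + e * (k == i)%:R) y =
  (1 - e) *: comb l y + e *: y i.
Proof.
rewrite /comb; under eq_bigr do rewrite scalerDl -!scalerA.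
rewrite big_split /= -!scaler_sumr; congr (_ + _ *: _).
rewrite (bigD1 i) //= eqxx scale1r big1 ?addr0 // => k /negbTE ->.
by rewrite scale0r.
Qed.

Lemma comb_min (G : set 'rV[R]_d) : compact G -> G !=set0 ->
  exists l y, [/\ weights l, forall i, G (y i) &
    forall l' y', weights l' -> (forall i, G (y' i)) ->
    rdot (comb l y) (comb l y) <= rdot (comb l' y') (comb l' y')].
Proof.
move=> cG [g0 Gg0].
pose A := [set u : 'rV[R]_d.+1 | forall i, `[0, 1]%classic (u ord0 i)].
pose B := [set u : 'rV['rV[R]_d]_d.+1 | forall i, G (u ord0 i)].
pose T := ('rV[R]_d.+1 * 'rV['rV[R]_d]_d.+1)%type.
have ctA : compact A by apply: (rV_compact (fun=> @segment_compact R 0 1)).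
have ctB : compact B by apply: (rV_compact (fun=> cG)).
have u1_cont (u : T) i : (v : T).1 ord0 i @[v --> u] --> u.1 ord0 i.
  exact: (cvg_comp _ _ (@cvg_fst _ _ (nbhs u.1) (nbhs u.2) _)
    (@coord_continuous R _ _ ord0 i u.1)).
have u2_cont (u : T) i : (v : T).2 ord0 i @[v --> u] --> u.2 ord0 i.
  suff h : (v : 'rV['rV[R]_d]_d.+1) ord0 i @[v --> u.2] --> u.2 ord0 i.
    exact: (cvg_comp _ _ (@cvg_snd _ _ (nbhs u.1) (nbhs u.2) _) h).
  move=> V Vu; exists (fun _ j => if j == i then V else setT).
    by move=> k j; case: eqP => [->|_]; [rewrite (ord1 k)|exact: filterT].
  by move=> M /(_ ord0 i); rewrite eqxx.
pose D := (A `*` B) `&` [set u : T | \sum_i u.1 ord0 i = 1].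
have cD : compact D.
  apply: compact_setI_closed_in; first exact: compact_setX.
  move=> u _ /eqP hu.
  have cs : \sum_i (v : T).1 ord0 i @[v --> u] --> \sum_i u.1 ord0 i.
    by apply: cvg_sumr => i; exact: u1_cont.
  have : \forall v \near u, \sum_i (v : T).1 ord0 i != 1.
    exact: (cs _ (open_nbhs_nbhs (conj (@open_neq R 1) hu))).
  by apply: filterS => v /eqP.
pose c (u : T) := comb (u.1 ord0) (u.2 ord0).
have c_cont (u : T) : c v @[v --> u] --> c u.
  apply: (iffLR (@cvg_mx _ _ _ (nbhs_filter u) _ _ _ _)) => i j.
  rewrite /c summxE; under eq_fun do rewrite summxE.
  apply: cvg_sumr => k; rewrite mxE; under eq_fun do rewrite mxE.
  apply: cvgM; first exact: u1_cont.
  exact: (iffRL (@cvg_mx _ _ _ (nbhs_filter u) _ _ _ _) (u2_cont u k) i j).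
have f_cont (u : T) : rdot (c v) (c v) @[v --> u] --> rdot (c u) (c u).
  apply: cvg_sumr => i.
  have h := iffRL (@cvg_mx _ _ _ (nbhs_filter u) _ _ _ _) (c_cont u) 0 i.
  exact: cvgM.
have [] := @compact_EVT_min T R (fun u => rdot (c u) (c u)) D _ cD.
- exists (\row_j (j == ord0)%:R, const_mx g0); split=> /=.
    split=> /= i; rewrite /= !mxE //=.
    by rewrite in_itv /= ler0n lern1 leq_b1.
  under eq_bigr do rewrite mxE.
  by rewrite (bigD1 ord0) //= big1 ?addr0 // => i /negbTE ->.
- exact: continuous_subspaceT.
move=> u; rewrite inE => -[[uA uB] u1] umin.
exists (u.1 ord0), (u.2 ord0); split=> //.
  by split=> // i; have := uA i; rewrite /= in_itv /= => /andP[].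
move=> l' y' [l0 l1] Gy.
have := umin (\row_i l' i, \row_i y' i); rewrite /c /=.
have -> : comb ((\row_i l' i) ord0) ((\row_i y' i) ord0) = comb l' y'.
  by apply: eq_bigr => i _; rewrite !mxE.
apply; rewrite inE; split; last by move=> /=; under eq_bigr do rewrite mxE.
split=> i /=; rewrite mxE // in_itv /= l0 /= -l1 (bigD1 i) //= lerDl.
by apply: sumr_ge0.
Qed.

(** Caratheodory's reduction: d+1 points of an affine hyperplane of R^d that
    misses the origin are affinely dependent, so the weights can be moved along
    an affine relation until one of them vanishes. *)
Lemma comb_drop l y c : weights l -> (forall i, 0 < l i) -> c != 0 ->
  (forall i, rdot (y i) c = rdot c c) ->
  exists l' j, [/\ weights l', l' j = 0 & comb l' y = comb l y].
Proof.
move=> [l0 l1] lp cn0 yc.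
pose Y : 'M[R]_(d.+1, d) := \matrix_i y i.
have cc : rdot c c != 0 by apply: contra cn0 => /eqP /rdot_eq0 ->.
have : kermx Y != 0.
  rewrite kermx_eq0 /row_free; apply/eqP => hY.
  by have := rank_leq_col Y; rewrite hY ltnn.
case/rowV0Pn => mu /sub_kermxP muY mun0.
have muy : \sum_i mu 0 i *: y i = 0.
  rewrite -[RHS]muY; apply/rowP => j; rewrite summxE mxE.
  by apply: eq_bigr => i _; rewrite !mxE.
have mu0 : \sum_i mu 0 i = 0.
  have : rdot (\sum_i mu 0 i *: y i) c = 0.
    by rewrite muy /rdot big1 // => i _; rewrite mxE mul0r.
  rewrite rdot_suml; under eq_bigr do rewrite rdotZl yc.
  by rewrite -mulr_suml => /eqP; rewrite mulf_eq0 (negbTE cc) orbF => /eqP.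
have [i0 mui0] : exists i, 0 < mu 0 i.
  apply: contrapT => hn; move/negP: mun0; apply; apply/eqP/rowP => i.
  have hle k : 0 <= - mu 0 k.
    by rewrite oppr_ge0 leNgt; apply/negP => h; apply: hn; exists k.
  have : \sum_i - mu 0 i = 0 by rewrite sumrN mu0 oppr0.
  move/eqP; rewrite psumr_eq0 // => /allP /(_ i (mem_index_enum i)).
  by rewrite oppr_eq0 mxE => /eqP.
pose j := [arg min_(i < i0 | 0 < mu 0 i) (l i / mu 0 i)]%O.
have [muj jmin] : 0 < mu 0 j /\ forall i, 0 < mu 0 i ->
    l j / mu 0 j <= l i / mu 0 i by rewrite /j; case: arg_minP.
exists (fun i => l i - l j / mu 0 j * mu 0 i), j; split.
- split=> [i|]; last by rewrite sumrB -mulr_sumr mu0 mulr0 subr0.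
  have [mui|mui] := ltrP 0 (mu 0 i).
    by rewrite subr_ge0 -ler_pdivlMr // jmin.
  rewrite subr_ge0 (le_trans _ (l0 i)) // mulr_ge0_le0 // divr_ge0 //.
  exact: ltW.
- by rewrite divfK ?subrr // gt_eqF.
- rewrite /comb; under eq_bigr do rewrite scalerBl -scalerA.
  by rewrite sumrB -scaler_sumr muy scaler0 subr0.
Qed.

End ConvexHull.

(** Take the shortest convex combination c of d+1 gradients. If c is not 0, the
    points that carry it lie in the hyperplane through c normal to c, so one of
    them can be dropped; putting any other gradient in its place cannot shorten
    c, so all gradients lie beyond that hyperplane and -c is a common descent
    direction. *)
Lemma gordan (R : realType) (X : topologicalType) d (S : set X)
    (g : X -> 'rV[R]_d) :
  compact S -> (forall x, S x -> g @ x --> g x) ->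
  (forall v, exists x, S x /\ 0 <= rdot (g x) v) ->
  exists (x : 'I_d.+1 -> X) (l : 'I_d.+1 -> R),
    [/\ forall i, S (x i), weights l & \sum_i l i *: g (x i) = 0].
Proof.
move=> cS gc hv.
have cG : compact (g @` S).
  apply: continuous_compact cS; apply: continuous_in_subspaceT => x.
  by rewrite inE; exact: gc.
have [x0 [Sx0 _]] := hv 0.
have [|l [y [wl Gy lmin]]] := comb_min cG; first by exists (g x0), x0.
suff c0 : comb l y = 0.
  have /choice [x xP] : forall i, exists x, S x /\ g x = y i.
    by move=> i; have [z Sz <-] := Gy i; exists z.
  exists x, l; split=> // [i|]; first by case: (xP i).
  by rewrite -[RHS]c0; apply: eq_bigr => i _; case: (xP i) => _ ->.
apply/eqP/negPn/negP => cn0; set c := comb l y in lmin cn0.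
have yge i : rdot c c <= rdot (y i) c.
  apply: rdot_min_dir => e e0 e1; rewrite -comb_move.
  exact: lmin (weights_move i wl e0 e1) Gy.
(* a slot of weight 0 lets an arbitrary gradient enter the combination *)
have [l' [j [wl' lj cE]]] : exists l' j, [/\ weights l', l' j = 0 & comb l' y = c].
  have [[j lj]|lp] := pselect (exists j, l j = 0); first by exists l, j.
  have {}lp i : 0 < l i.
    rewrite lt_def (proj1 wl) andbT; apply/eqP => li; apply: lp.
    by exists i.
  apply: (comb_drop wl lp cn0) => i.
  have : \sum_i l i * (rdot (y i) c - rdot c c) = 0.
    under eq_bigr do rewrite mulrBr.
    by rewrite sumrB -rdot_comb -mulr_suml (proj2 wl) mul1r subrr.
  move/eqP; rewrite psumr_eq0 => [/allP /(_ i (mem_index_enum i))|k _].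
    by rewrite mulf_eq0 gt_eqF //= subr_eq0 => /eqP.
  by rewrite mulr_ge0 ?(proj1 wl) // subr_ge0.
have [x [Sx]] := hv (- c).
suff : rdot c c <= rdot (g x) c.
  move=> h; rewrite rdotC rdotNl oppr_ge0 rdotC => h'.
  have : rdot c c = 0 by apply/eqP; rewrite eq_le rdot_ge0 (le_trans h h').
  by move/rdot_eq0/eqP; rewrite (negbTE cn0).
pose y' i := if i == j then g x else y i.
have cE' : comb l' y' = c.
  rewrite -cE; apply: eq_bigr => i _; rewrite /y'.
  by case: eqP => // ->; rewrite lj !scale0r.
apply: rdot_min_dir => e e0 e1.
have -> : g x = y' j by rewrite /y' eqxx.
rewrite -[in leRHS]cE' -comb_move; apply: lmin (weights_move j wl' e0 e1) _ => i.
by rewrite /y'; case: eqP => _ //; exists x.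
Qed.

(** * Complex vectors as pairs of real columns *)

Lemma addmxE (V : nmodType) m n (A B : 'M[V]_(m, n)) i j :
  (A + B) i j = A i j + B i j.
Proof. exact: mxE. Qed.

Lemma oppmxE (V : zmodType) m n (A : 'M[V]_(m, n)) i j : (- A) i j = - A i j.
Proof. exact: mxE. Qed.

Lemma scalemxE (R : pzRingType) m n a (A : 'M[R]_(m, n)) i j :
  (a *: A) i j = a * A i j.
Proof. exact: mxE. Qed.

Lemma zeromxE (V : nmodType) m n i j : (0 : 'M[V]_(m, n)) i j = 0.
Proof. exact: mxE. Qed.

(* additive identities between matrices, checked entrywise *)
Ltac mxlin := apply/matrixP => ? ?;
  rewrite ?(addmxE, oppmxE, scalemxE, zeromxE); ring.

Section Frobenius.
Variable R : realType.

Definition fro a b (X Y : 'M[R]_(a, b)) : R := \tr (X^T *m Y).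

Variables a b : nat.
Implicit Types X Y Z : 'M[R]_(a, b).

Lemma froE X Y : fro X Y = \sum_j \sum_i X i j * Y i j.
Proof.
by apply: eq_bigr => j _; rewrite mxE; apply: eq_bigr => i _; rewrite mxE.
Qed.

Lemma froC X Y : fro X Y = fro Y X.
Proof. by rewrite /fro -mxtrace_tr trmx_mul trmxK. Qed.

Lemma froDl X Y Z : fro (X + Y) Z = fro X Z + fro Y Z.
Proof. by rewrite /fro linearD mulmxDl mxtraceD. Qed.

Lemma froZl k X Z : fro (k *: X) Z = k * fro X Z.
Proof. by rewrite /fro linearZ /= -scalemxAl mxtraceZ. Qed.

Lemma froNl X Z : fro (- X) Z = - fro X Z.
Proof. by rewrite -scaleN1r froZl mulN1r. Qed.

Lemma froBl X Y Z : fro (X - Y) Z = fro X Z - fro Y Z.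
Proof. by rewrite froDl froNl. Qed.

Lemma froDr X Y Z : fro X (Y + Z) = fro X Y + fro X Z.
Proof. by rewrite froC froDl !(froC X). Qed.

Lemma froZr k X Z : fro X (k *: Z) = k * fro X Z.
Proof. by rewrite froC froZl froC. Qed.

Lemma froNr X Z : fro X (- Z) = - fro X Z.
Proof. by rewrite froC froNl froC. Qed.

Lemma froBr X Y Z : fro X (Y - Z) = fro X Y - fro X Z.
Proof. by rewrite froDr froNr. Qed.

Lemma fro0l X : fro 0 X = 0.
Proof. by rewrite /fro trmx0 mul0mx mxtrace0. Qed.

Lemma fro0r X : fro X 0 = 0.
Proof. by rewrite froC fro0l. Qed.

Lemma fro_ge0 X : 0 <= fro X X.
Proof.
by rewrite froE; apply: sumr_ge0 => j _; apply: sumr_ge0 => i _;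
  rewrite -expr2 sqr_ge0.
Qed.

Lemma sqr_entry_le_fro X i j : X i j ^+ 2 <= fro X X.
Proof.
rewrite froE (bigD1 j) //= (bigD1 i) //= -expr2 -addrA lerDl.
rewrite addr_ge0 // sumr_ge0 // => k _; last rewrite sumr_ge0 // => l _.
all: by rewrite -expr2 sqr_ge0.
Qed.

Lemma fro_eq0 X : fro X X = 0 -> X = 0.
Proof.
move=> X0; apply/matrixP => i j; rewrite mxE; apply/eqP.
by rewrite -sqrf_eq0 eq_le sqr_ge0 -X0 sqr_entry_le_fro.
Qed.

Lemma fro_cauchy X Y : fro X Y ^+ 2 <= fro X X * fro Y Y.
Proof.
have [Y0|Y0] := eqVneq (fro Y Y) 0.
  by rewrite (fro_eq0 Y0) !fro0r expr0n mulr0.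
have Yp : 0 < fro Y Y by rewrite lt_def Y0 fro_ge0.
have := fro_ge0 (fro Y Y *: X - fro X Y *: Y).
rewrite froBl !froBr !froZl !froZr (froC Y X).
suff -> : fro Y Y * (fro Y Y * fro X X) - fro Y Y * (fro X Y * fro X Y) -
    (fro X Y * (fro Y Y * fro X Y) - fro X Y * (fro X Y * fro Y Y)) =
    fro Y Y * (fro X X * fro Y Y - fro X Y ^+ 2).
  by rewrite pmulr_rge0 // subr_ge0.
by ring.
Qed.

End Frobenius.

Lemma fro_mulmxl (R : realType) a b c (A : 'M[R]_(c, a)) (X : 'M[R]_(a, b))
  (Y : 'M[R]_(c, b)) : fro (A *m X) Y = fro X (A^T *m Y).
Proof. by rewrite /fro trmx_mul mulmxA. Qed.

Lemma fro_mulmxr (R : realType) a b c (A : 'M[R]_(a, c)) (X : 'M[R]_(c, b))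
  (Y : 'M[R]_(a, b)) : fro Y (A *m X) = fro (A^T *m Y) X.
Proof. by rewrite froC fro_mulmxl froC. Qed.

Lemma fro_col (R : realType) a1 a2 b (X1 Y1 : 'M[R]_(a1, b))
    (X2 Y2 : 'M[R]_(a2, b)) :
  fro (col_mx X1 X2) (col_mx Y1 Y2) = fro X1 Y1 + fro X2 Y2.
Proof. by rewrite /fro tr_col_mx mul_row_col mxtraceD. Qed.

Lemma fro_outer (R : realType) a b k (x : 'M[R]_(a, k)) (y : 'M[R]_(b, k)) v :
  fro (x *m y^T) v = fro x (v *m y).
Proof. by rewrite /fro trmx_mul trmxK -mulmxA mxtrace_mulC mulmxA. Qed.

Lemma rdot_mxvec (R : realType) a b (X Y : 'M[R]_(a, b)) :
  rdot (mxvec X) (mxvec Y) = fro X Y.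
Proof.
rewrite /rdot (reindex _ (curry_mxvec_bij _ _)) /=.
rewrite froE exchange_big /= pair_bigA /=.
by apply: eq_bigr => -[i j] _ /=; rewrite !mxvecE.
Qed.

Section ComplexAsReal.
Variable R : realType.

(** A complex vector is a real matrix with two columns, its real and imaginary
    parts; multiplication by the imaginary unit is then right multiplication by
    this skew matrix, and commutes with real matrices acting on the left. *)
Definition Jmx : 'M[R]_2 := \matrix_(i, j) (j%:R - i%:R).

Lemma tr_Jmx : Jmx^T = - Jmx.
Proof. by apply/matrixP => i j; rewrite !mxE opprB. Qed.

Lemma Jmx_sqr : Jmx *m Jmx = - 1%:M.
Proof.
apply/matrixP => i j; rewrite !mxE !big_ord_recl big_ord0 !mxE /=.
case: i => -[|[|//]] hi; case: j => -[|[|//]] hj; rewrite /bump /=; ring.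
Qed.

Lemma mulmxJJ n (X : 'M[R]_(n, 2)) : X *m Jmx *m Jmx = - X.
Proof. by rewrite -mulmxA Jmx_sqr mulmxN mulmx1. Qed.

Lemma fro_J n (X Y : 'M[R]_(n, 2)) : fro (X *m Jmx) Y = - fro X (Y *m Jmx).
Proof.
rewrite /fro trmx_mul tr_Jmx -mulmxA mxtrace_mulC mulmxN linearN /=.
by rewrite mulmxA.
Qed.

(** For nonzero c and w = s / c this is c^2 (A - jw)(A + jw), a real matrix. *)
Definition rden n (A : 'M[R]_n) (c s : R) : 'M[R]_n :=
  c ^+ 2 *: (A *m A) + (s ^+ 2)%:M.

(** The solution x of (js - cA) x = Y, rationalised: the inverse of js - cA is
    -(cA + js) / (c^2 A^2 + s^2). *)
Definition rsol n (A : 'M[R]_n) (c s : R) (Y : 'M[R]_(n, 2)) : 'M[R]_(n, 2) :=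
  - (invmx (rden A c s) *m (c *: (A *m Y) + s *: (Y *m Jmx))).

Lemma rdenC n (A : 'M[R]_n) c s : A *m rden A c s = rden A c s *m A.
Proof.
by rewrite /rden mulmxDl mulmxDr -scalemxAl -scalemxAr mulmxA scalar_mxC.
Qed.

Lemma rden_invC n (A : 'M[R]_n) c s : rden A c s \in unitmx ->
  A *m invmx (rden A c s) = invmx (rden A c s) *m A.
Proof.
move=> u; apply: (can_inj (mulKmx u)); rewrite mulmxA -rdenC mulKVmx //.
by rewrite mulmxK.
Qed.

Lemma rsolP n (A : 'M[R]_n) c s Y : rden A c s \in unitmx ->
  s *: (rsol A c s Y *m Jmx) - c *: (A *m rsol A c s Y) = Y.
Proof.
move=> u; rewrite /rsol; set N := rden A c s.
set V := c *: (A *m Y) + s *: (Y *m Jmx).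
have -> : s *: (- (invmx N *m V) *m Jmx) - c *: (A *m - (invmx N *m V)) =
    invmx N *m (c *: (A *m V) - s *: (V *m Jmx)).
  rewrite mulmxBr -!scalemxAr !mulmxA -rden_invC // mulNmx mulmxN !scalerN opprK.
  by rewrite addrC ?mulmxA.
have -> : c *: (A *m V) - s *: (V *m Jmx) = N *m Y; last by rewrite mulKmx.
rewrite /V /N /rden mulmxDl mulmxDr !mulmxDl -!scalemxAl -!scalemxAr mulmxJJ.
rewrite mul_scalar_mx !mulmxA; mxlin.
Qed.

Lemma rsol_uniq n (A : 'M[R]_n) c s X Y : rden A c s \in unitmx ->
  s *: (X *m Jmx) - c *: (A *m X) = Y -> X = rsol A c s Y.
Proof.
move=> u <-; rewrite /rsol; apply: (can_inj (mulKmx u)).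
rewrite mulmxN mulKVmx // /rden mulmxDl mulmxBl mulmxBr -!scalemxAl.
by rewrite -!scalemxAr mul_scalar_mx mulmxJJ -!mulmxA; mxlin.
Qed.

Lemma rsolZ n (A : 'M[R]_n) c s a Y :
  a *: rsol A c s Y = rsol A c s (a *: Y).
Proof.
rewrite /rsol scalerN scalemxAr; congr (- (_ *m _)).
by rewrite -scalemxAr -scalemxAl; mxlin.
Qed.

Lemma trmx_rden n (A : 'M[R]_n) c s : rden A^T c (- s) = (rden A c s)^T.
Proof.
by rewrite /rden linearD linearZ /= trmx_mul tr_scalar_mx sqrrN.
Qed.

Lemma cvg_rden (T : Type) (F : set_system T) {FF : Filter F} n
    (A : T -> 'M[R]_n) (c s : T -> R) A0 c0 s0 :
  A @ F --> A0 -> c @ F --> c0 -> s @ F --> s0 ->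
  rden (A t) (c t) (s t) @[t --> F] --> rden A0 c0 s0.
Proof.
move=> hA hc hs; apply: cvg_addmx.
  apply: cvg_scalemx; last exact: cvg_mulmx.
  by rewrite expr2; under eq_fun do rewrite expr2; exact: cvgM.
rewrite -scalemx1; under eq_fun do rewrite -scalemx1.
apply: cvg_scalemx; last exact: cvg_cst.
by rewrite expr2; under eq_fun do rewrite expr2; exact: cvgM.
Qed.

Lemma cvg_rsol (T : Type) (F : set_system T) {FF : Filter F} n
    (A : T -> 'M[R]_n) (c s : T -> R) (Y : T -> 'M[R]_(n, 2)) A0 c0 s0 Y0 :
  rden A0 c0 s0 \in unitmx -> A @ F --> A0 -> c @ F --> c0 -> s @ F --> s0 ->
  Y @ F --> Y0 ->
  rsol (A t) (c t) (s t) (Y t) @[t --> F] --> rsol A0 c0 s0 Y0.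
Proof.
move=> u hA hc hs hY; apply: cvg_oppmx; apply: cvg_mulmx.
  by apply: cvg_invmx => //; exact: cvg_rden.
apply: cvg_addmx; apply: cvg_scalemx => //; apply: cvg_mulmx => //.
exact: cvg_cst.
Qed.

End ComplexAsReal.

(** c = 0 stands for the infinite frequency, to which the state does not respond. *)
Lemma infinite_freq_eq0 (R : realType) N (x y : 'M[R]_(N, 2)) c s :
  c ^+ 2 + s ^+ 2 = 1 -> s *: (x *m Jmx R) = c *: y -> c = 0 -> x = 0.
Proof.
move=> cs e c0; move: e cs; rewrite c0 scale0r expr0n add0r => e s1.
have s0 : s != 0.
  by apply/eqP => s0; move: s1; rewrite s0 expr0n => /eqP; rewrite eq_sym oner_eq0.
have xJ : x *m Jmx R = 0.
  by move/eqP: e; rewrite scaler_eq0 (negbTE s0) => /eqP.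
by apply: oppr_inj; rewrite -mulmxJJ xJ mul0mx oppr0.
Qed.

Lemma finite_freq (R : realType) N (x y : 'M[R]_(N, 2)) c s :
  c != 0 -> s *: (x *m Jmx R) = c *: y -> (s / c) *: (x *m Jmx R) = y.
Proof.
by move=> c0 e; rewrite mulrC -scalerA e scalerA mulVf // scale1r.
Qed.

(** * The largest singular value *)

Lemma sup_of_ge0 (R : realType) (S : set R) : (forall s, S s -> 0 <= s) -> 0 <= sup S.
Proof.
move=> S0; have [hS|/sup_out -> //] := pselect (has_sup S).
have [[s Ss] _] := hS; apply: le_trans (S0 _ Ss) _.
exact: sup_upper_bound.
Qed.

Section SingularValues.
Local Open Scope sesquilinear_scope.
Local Open Scope complex_scope.
Variable R : realType.

Definition toC n (X : 'M[R]_(n, 2)) : 'cV[R[i]]_n :=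
  \col_k (X k 0 +i* X k 1).

Definition ofC n (x : 'cV[R[i]]_n) : 'M[R]_(n, 2) :=
  \matrix_(k, j) if j == 0 then complex.Re (x k 0) else complex.Im (x k 0).

Lemma ofCK n : cancel (@ofC n) (@toC n).
Proof.
by move=> x; apply/colP => k; rewrite !mxE /=; case: (x k 0).
Qed.

Lemma toCD n (X Y : 'M[R]_(n, 2)) : toC (X + Y) = toC X + toC Y.
Proof. by apply/colP => k; rewrite !mxE. Qed.

Lemma toCZ n (a : R) (X : 'M[R]_(n, 2)) : toC (a *: X) = a%:C *: toC X.
Proof. by apply/colP => k; rewrite !mxE; simpc. Qed.

Lemma sum_complex (I : Type) (r : seq I) (f g : I -> R) :
  \sum_(i <- r) (f i +i* g i) = (\sum_(i <- r) f i) +i* (\sum_(i <- r) g i).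
Proof.
elim: r => [|i r IH]; first by rewrite !big_nil.
by rewrite !big_cons IH.
Qed.

Lemma toC_mulmx m n (A : 'M[R]_(m, n)) (X : 'M[R]_(n, 2)) :
  toC (A *m X) = complexmx A *m toC X.
Proof.
apply/colP => k; rewrite !mxE -sum_complex; apply: eq_bigr => j _.
by rewrite !mxE; simpc.
Qed.

Lemma toCJ n (X : 'M[R]_(n, 2)) : toC (X *m Jmx R) = 'i *: toC X.
Proof.
apply/colP => k; rewrite !mxE !big_ord_recl !big_ord0 !mxE /=; simpc.
have -> : lift ord0 ord0 = 1 :> 'I_2 by apply: val_inj.
by rewrite /=; congr (_ +i* _); ring.
Qed.

Lemma conjCE (x : R[i]) : Num.conj x = x^*%C.
Proof. by []. Qed.

Lemma toC_dot n (Z X : 'M[R]_(n, 2)) :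
  complex.Re (((toC Z)^t* *m toC X) 0 0) = fro Z X.
Proof.
rewrite mxE froE !big_ord_recl big_ord0 addr0 -big_split /=.
have -> : lift ord0 ord0 = 1 :> 'I_2 by apply: val_inj.
rewrite (eq_bigr (fun k => (Z k 0 * X k 0 + Z k 1 * X k 1) +i*
    (Z k 0 * X k 1 - Z k 1 * X k 0))).
  by rewrite sum_complex.
move=> k _; rewrite !mxE conjCE /=; simpc; congr (_ +i* _); ring.
Qed.

Lemma toC_norm n (X : 'M[R]_(n, 2)) :
  ((toC X)^t* *m toC X) 0 0 = (fro X X)%:C.
Proof.
rewrite -toC_dot mxE -[LHS]RRe_real //.
rewrite rpred_sum // => k _; rewrite !mxE conjCE mulrC -sqr_normc.
by rewrite rpredX // normr_real.
Qed.

Lemma singular_valueP m n (M : 'M[R[i]]_(m, n)) (s : R) : singular_value M s ->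
  exists2 x : 'cV[R[i]]_n, x != 0 & M^t* *m M *m x = (s ^+ 2)%:C *: x.
Proof.
case=> s0 /eigenvalueP [v vH v0]; exists (v^t* ).
  apply: contra v0 => /eqP h; rewrite -[v](trmxCK v) h.
  by apply/eqP/rowP => i; rewrite !mxE rmorph0.
have /(congr1 (fun X => X^t* )) := vH.
rewrite !trmx_mul !map_mxM /= trmxCK linearZ /= map_mxZ /= conjCE conjc_real.
by [].
Qed.

Lemma gram_norm m n (M : 'M[R[i]]_(m, n)) (x : 'cV[R[i]]_n) :
  (x^t* *m (M^t* *m M *m x)) 0 0 = ((M *m x)^t* *m (M *m x)) 0 0.
Proof. by rewrite trmx_mul map_mxM !mulmxA. Qed.

(** v M^* M v^* is the squared norm of M v^*, so an eigenvalue of the Gram matrix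
    is a nonnegative real, hence a square. *)
Lemma gram_eigenvalue m n (M : 'M[R[i]]_(m, n)) (l : R[i]) :
  eigenvalue (M^t* *m M) l -> exists2 s : R, l = (s ^+ 2)%:C & 0 <= s.
Proof.
case/eigenvalueP => v vH v0.
have vv : (v *m v^t* ) 0 0 = (fro (ofC (v^t* )) (ofC (v^t* )))%:C.
  by rewrite -toC_norm ofCK trmxCK.
have vv0 : 0 < fro (ofC (v^t* )) (ofC (v^t* )).
  rewrite lt_def fro_ge0 andbT; apply: contra v0 => /eqP /fro_eq0 h.
  have := trmxCK v; rewrite -[in LHS](ofCK (v^t* )) h => <-.
  by apply/eqP/rowP => i; rewrite !mxE /= conjCE; simpc.
have : (v *m (M^t* *m M) *m v^t* ) 0 0 =
    (fro (ofC (M *m v^t* )) (ofC (M *m v^t* )))%:C.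
  by rewrite -toC_norm ofCK trmx_mul map_mxM trmxCK !mulmxA.
rewrite vH -scalemxAl mxE vv => h.
set q := fro _ _ in h vv0; set p := fro _ _ in h.
have lE : l = (p / q)%:C.
  rewrite rmorphM /= fmorphV /= -h mulfK //.
  by rewrite (inj_eq (@complexI R)) gt_eqF.
exists (Num.sqrt (p / q)); last exact: sqrtr_ge0.
by rewrite sqr_sqrtr // divr_ge0 // ?fro_ge0 // ltW.
Qed.

(** The Gram matrix is unitarily diagonalisable. Its largest diagonal value is
    the square of a singular value and bounds the quadratic form, hence all
    singular values: the supremum is attained. *)
Lemma sigma_max_spec m n (M : 'M[R[i]]_(m, n)) : (0 < n)%N ->
  singular_value M (sigma_max M) /\
  forall X : 'M[R]_(n, 2), ((M *m toC X)^t* *m (M *m toC X)) 0 0 <=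
    (sigma_max M ^+ 2 * fro X X)%:C.
Proof.
move=> n0; set H := M^t* *m M.
have Hherm : H^t* = H by rewrite /H trmx_mul map_mxM trmxCK.
have Hnorm : H \is normalmx by apply/normalmxP; rewrite Hherm.
have HE := orthomx_spectralP Hnorm.
set P := spectralmx H in HE; set D := spectral_diag H in HE.
have PU : P \is unitarymx by exact: spectral_unitarymx.
have Pu : P \in unitmx by exact: spectral_unit.
have Deig i : eigenvalue H (D 0 i).
  apply/eigenvalueP; exists (row i P).
    rewrite -row_mul HE !mulmxA mulmxV // mul1mx.
    by rewrite row_mul row_diag_mx -scalemxAl -rowE.
  apply/negP => /eqP Pi0.
  have := mulmxV Pu => /(congr1 (row i)); rewrite row_mul Pi0 mul0mx.
  move=> /rowP /(_ i); rewrite !mxE eqxx => /eqP; rewrite eq_sym.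
  by rewrite oner_eq0.
have [d dE d0] : exists2 d : 'I_n -> R, forall i, D 0 i = (d i ^+ 2)%:C &
    forall i, 0 <= d i.
  have /choice [d dP] : forall i, exists s : R, D 0 i = (s ^+ 2)%:C /\ 0 <= s.
    by move=> i; have [s ? ?] := gram_eigenvalue (Deig i); exists s.
  by exists d => i; case: (dP i).
pose k : 'I_n := [arg max_(i > Ordinal n0) d i]%O.
have kmax i : d i <= d k by rewrite /k; case: arg_maxP => // j _; apply.
have bound (X : 'M[R]_(n, 2)) : ((M *m toC X)^t* *m (M *m toC X)) 0 0 <=
    (d k ^+ 2 * fro X X)%:C.
  rewrite -gram_norm -/H HE invmx_unitary //.
  set u := P *m toC X.
  have -> : (toC X)^t* *m (P^t* *m diag_mx D *m P *m toC X) =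
     u^t* *m (diag_mx D *m u) by rewrite /u trmx_mul map_mxM !mulmxA.
  have -> : fro X X = fro (ofC u) (ofC u).
    apply: (@complexI R); rewrite -!toC_norm ofCK /u trmx_mul map_mxM.
    rewrite mulmxA -(mulmxA _ _ P) -invmx_unitary // mulVmx //.
    by rewrite mulmx1.
  rewrite rmorphM /= -toC_norm ofCK !mxE mulr_sumr; apply: ler_sum => i _.
  rewrite mul_diag_mx !mxE dE conjCE mulrCA.
  apply: ler_wpM2r; last by rewrite lecR ler_pXn2r ?nnegrE.
  by rewrite mulrC -sqr_normc exprn_ge0.
have sk : singular_value M (d k).
  by split => //; rewrite -dE; exact: Deig.
suff -> : sigma_max M = d k by [].
have ub : ubound [set s | singular_value M s] (d k).
  move=> s /= hs; have [s0 _] := hs; have [x x0 Hx] := singular_valueP hs.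
  have := bound (ofC x); rewrite ofCK -gram_norm Hx -scalemxAr mxE.
  rewrite -[in X in _ * X](ofCK x) toC_norm -rmorphM /= lecR.
  rewrite ler_pM2r; first by rewrite ler_pXn2r ?nnegrE.
  rewrite lt_def fro_ge0 andbT; apply: contra x0 => /eqP /fro_eq0 h.
  by rewrite -(ofCK x) h; apply/eqP/colP => i; rewrite !mxE.
apply/eqP; rewrite eq_le; apply/andP; split.
  by apply: ge_sup => //; exists (d k).
by apply: ub_le_sup => //; exists (d k).
Qed.

Lemma sigma_max_ge0 m n (M : 'M[R[i]]_(m, n)) : 0 <= sigma_max M.
Proof. by apply: sup_of_ge0 => s []. Qed.

Section RealForm.
Variables (m n : nat) (M : 'M[R[i]]_(m, n)).
Variable f : 'M[R]_(n, 2) -> 'M[R]_(m, 2).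
Hypothesis fE : forall X, toC (f X) = M *m toC X.
Hypothesis n_gt0 : (0 < n)%N.

(** Together with the next lemma: the largest singular value is the maximum of
    Re (z^* M x) over the unit balls, here in real form. *)
Lemma fro_le_sigma_max X Z : fro X X <= 1 -> fro Z Z <= 1 ->
  fro Z (f X) <= sigma_max M.
Proof.
move=> X1 Z1; have [_ h] := sigma_max_spec M n_gt0.
have := h X; rewrite -fE toC_norm lecR => fX.
have s0 := sigma_max_ge0 M.
have : fro Z (f X) ^+ 2 <= sigma_max M ^+ 2.
  apply: le_trans (fro_cauchy _ _) _.
  apply: (@le_trans _ _ (fro (f X) (f X))).
    by rewrite ler_piMl // fro_ge0.
  by apply: le_trans fX _; rewrite ler_piMr // sqr_ge0.
have [neg _|pos] := ltrP (fro Z (f X)) 0; first exact: le_trans (ltW neg) s0.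
by rewrite ler_pXn2r ?nnegrE.
Qed.

Lemma sigma_max_attained : exists X Z,
  [/\ fro X X <= 1, fro Z Z <= 1 & fro Z (f X) = sigma_max M].
Proof.
have [/[dup] [[s0 _]] /singular_valueP [x x0 Hx] _] := sigma_max_spec M n_gt0.
have [s_eq0|s_neq0] := eqVneq (sigma_max M) 0.
  by exists 0, 0; rewrite !fro0l s_eq0 ler01.
have sp : 0 < sigma_max M by rewrite lt_def s_neq0.
pose q := fro (ofC x) (ofC x).
have q0 : 0 < q.
  rewrite lt_def fro_ge0 andbT; apply: contra x0 => /eqP /fro_eq0 h.
  by rewrite -(ofCK x) h; apply/eqP/colP => i; rewrite !mxE.
pose X := (Num.sqrt q)^-1 *: ofC x.
have XX : fro X X = 1.
  rewrite froZl froZr mulrA -invfM -expr2 sqr_sqrtr ?ltW //.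
  by rewrite mulVf ?gt_eqF.
have fXX : fro (f X) (f X) = sigma_max M ^+ 2.
  have HX : M^t* *m M *m toC X = (sigma_max M ^+ 2)%:C *: toC X.
    by rewrite toCZ ofCK -scalemxAr Hx !scalerA mulrC.
  apply: (@complexI R); rewrite -toC_norm fE -gram_norm HX -scalemxAr mxE.
  by rewrite toC_norm XX mulr1.
exists X, ((sigma_max M)^-1 *: f X); split; first by rewrite XX.
  rewrite froZl froZr fXX mulrA -invfM -expr2 mulVf //.
  by rewrite expf_neq0.
by rewrite froZl fXX expr2 mulKf.
Qed.

End RealForm.

End SingularValues.

(** * Closed-loop response to a sinusoidal disturbance *)

Section ImaginaryAxis.
Local Open Scope sesquilinear_scope.
Local Open Scope complex_scope.

Lemma mul_subadd_scalar (S : comNzRingType) n (A : 'M[S]_n) (a : S) :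
  (A - a%:M) *m (A + a%:M) = A *m A - (a ^+ 2)%:M.
Proof.
rewrite mulmxDr !mulmxBl -(scalar_mxC a A) -scalar_mxM expr2.
by rewrite addrA subrK.
Qed.

Lemma sqr_imag (R : realType) (w : R) : (0 +i* w) ^+ 2 = - (w ^+ 2)%:C.
Proof. by rewrite expr2; simpc; rewrite -expr2. Qed.

Lemma rden_complex (R : realType) n (A : 'M[R]_n) (c s : R) : c != 0 ->
  complexmx (rden A c s) = (c ^+ 2)%:C *:
    ((complexmx A - (0 +i* (s / c))%:M) *m (complexmx A + (0 +i* (s / c))%:M)).
Proof.
move=> c0; rewrite mul_subadd_scalar sqr_imag.
rewrite /rden /complexmx map_mxD map_mxZ map_mxM map_scalar_mx /=.
rewrite raddfN opprK scalerDr scale_scalar_mx -rmorphM /=; congr (_ + _%:C%:M).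
by rewrite expr_div_n mulrC divfK // sqrf_eq0.
Qed.

(** A zero of the determinant would be an eigenvalue of A on the imaginary axis. *)
Lemma hurwitz_rden_unit (R : realType) n (A : 'M[R]_n) (c s : R) :
  hurwitzmx A -> c ^+ 2 + s ^+ 2 = 1 -> rden A c s \in unitmx.
Proof.
move=> hA cs; have [c0|cn0] := eqVneq c 0.
  move: cs; rewrite /rden c0 expr0n add0r scale0r add0r => ->.
  exact: unitmx1.
have noeig w : complexmx A - (0 +i* w)%:M \in unitmx.
  rewrite -row_free_unit -kermx_eq0; apply/negPn/negP => h.
  by have := hA (0 +i* w) h; rewrite ltxx.
rewrite -(map_unitmx (real_complex R)) -/(complexmx _) rden_complex //.
rewrite unitmxZ; last by rewrite unitfE fmorph_eq0 sqrf_eq0.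
rewrite unitmx_mul noeig /=.
by have := noeig (- (s / c)); rewrite -raddfN /=; simpc.
Qed.

End ImaginaryAxis.

(** Pairing the costate l with the difference of the two state equations leaves
    only the discrepancies dx and dz, because multiplication by the imaginary
    unit is skew. *)
Lemma response_diff (R : realType) N q r (A A' : 'M[R]_N) (B B' : 'M[R]_(N, q))
    (C C' : 'M[R]_(r, N)) (D D' : 'M[R]_(r, q)) (c s : R) w z x x' l dx dz :
  s *: (x *m Jmx R) = c *: (A *m x + B *m w) ->
  s *: (x' *m Jmx R) = c *: (A' *m x' + B' *m w) ->
  - (s *: (l *m Jmx R)) - c *: (A^T *m l) = C^T *m z ->
  A' *m x' + B' *m w = A *m x' + B *m w + dx ->
  C' *m x' + D' *m w = C *m x' + D *m w + dz ->
  fro z (C' *m x' + D' *m w) - fro z (C *m x + D *m w) =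
  fro (c *: l) dx + fro z dz.
Proof.
move=> hx hx' hl eA ->.
have -> : fro z (C *m x' + D *m w + dz) - fro z (C *m x + D *m w) =
  fro (C^T *m z) (x' - x) + fro z dz.
  by rewrite -fro_mulmxr mulmxBr !froDr froNr; ring.
congr (_ + _); rewrite -hl froBl froNl froZl fro_J mulrN opprK.
have hd : s *: ((x' - x) *m Jmx R) = c *: (A *m (x' - x)) + c *: dx.
  by rewrite mulmxBl scalerBr hx hx' eA mulmxBr; mxlin.
by rewrite -froZr hd froDr !froZr !froZl -fro_mulmxr; ring.
Qed.

Section ClosedLoopResponse.
Variables (R : realType) (n m p : nat) (G : plant R n m p).
Implicit Types K : 'M[R]_(m + n, p + n).

(** The closed-loop matrices are affine in the policy; these are the constant
    factors through which it enters. *)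
Definition inB : 'M[R]_(n + n, m + n) := block_mx (pB G) 0 0 1%:M.
Definition outC : 'M[R]_(p + n, n + n) := block_mx (pC G) 0 0 1%:M.
Definition distD : 'M[R]_(p + n, n + p) := block_mx 0 (sqrtmx (pV G)) 0 0.
Definition perfD : 'M[R]_(n + m, m + n) := block_mx 0 0 (sqrtmx (pR G)) 0.

Lemma mul_inB K : inB *m K =
  block_mx (pB G *m DK K) (pB G *m CK K) (BK K) (AK K).
Proof.
rewrite -{1}(submxK K) /inB mulmx_block !mul0mx !mul1mx !addr0 !add0r.
by [].
Qed.

Lemma mul_perfD K : perfD *m K =
  block_mx 0 0 (sqrtmx (pR G) *m DK K) (sqrtmx (pR G) *m CK K).
Proof.
by rewrite -{1}(submxK K) /perfD mulmx_block !mul0mx !addr0.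
Qed.

Lemma AclE K : Acl G K = block_mx (pA G) 0 0 0 + inB *m K *m outC.
Proof.
rewrite mul_inB mulmx_block !mulmx0 !mulmx1 !addr0 !add0r.
by rewrite add_block_mx !add0r.
Qed.

Lemma BclE K : Bcl G K = block_mx (sqrtmx (pW G)) 0 0 0 + inB *m K *m distD.
Proof.
rewrite mul_inB mulmx_block !mulmx0 !addr0.
by rewrite add_block_mx !add0r !addr0.
Qed.

Lemma CclE K : Ccl G K = block_mx (sqrtmx (pQ G)) 0 0 0 + perfD *m K *m outC.
Proof.
rewrite mul_perfD mulmx_block !mulmx0 !mul0mx !mulmx1 !addr0 !add0r.
by rewrite add_block_mx !add0r !addr0.
Qed.

Lemma DclE K : Dcl G K = perfD *m K *m distD.
Proof.
by rewrite mul_perfD mulmx_block !mulmx0 !mul0mx !addr0.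
Qed.

Definition state K c s w : 'M[R]_(n + n, 2) :=
  rsol (Acl G K) c s (c *: (Bcl G K *m w)).

(** The adjoint equation -(js + cA^T) l = C^T z at the same frequency. *)
Definition costate K c s z : 'M[R]_(n + n, 2) :=
  rsol (Acl G K)^T c (- s) ((Ccl G K)^T *m z).

Definition resp K c s w : 'M[R]_(n + m, 2) :=
  Ccl G K *m state K c s w + Dcl G K *m w.

(** No closed-loop eigenvalue on the imaginary axis. Unlike stability this is seen
    on the circle of pairs (c, s), which is compact, so it persists nearby. *)
Definition regular K := forall c s : R,
  c ^+ 2 + s ^+ 2 = 1 -> rden (Acl G K) c s \in unitmx.

Lemma stabilizing_regular K : stabilizing G K -> regular K.
Proof. by move=> hK c s; exact: hurwitz_rden_unit. Qed.

Lemma stateP K c s w : rden (Acl G K) c s \in unitmx ->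
  s *: (state K c s w *m Jmx R) =
  c *: (Acl G K *m state K c s w + Bcl G K *m w).
Proof.
by move=> u; rewrite scalerDr -[X in _ + X](rsolP _ u) addrC subrK.
Qed.

Lemma costateP K c s z : rden (Acl G K) c s \in unitmx ->
  - (s *: (costate K c s z *m Jmx R)) - c *: ((Acl G K)^T *m costate K c s z) =
  (Ccl G K)^T *m z.
Proof.
by move=> u; rewrite -scaleNr rsolP // trmx_rden unitmx_tr.
Qed.

Local Open Scope complex_scope.

Lemma toC_resp K c s w : c != 0 -> rden (Acl G K) c s \in unitmx ->
  toC (resp K c s w) = transfer G K (s / c) *m toC w.
Proof.
move=> c0 u; set x := state K c s w.
have ux : (0 +i* (s / c))%:M - complexmx (Acl G K) \in unitmx.
  move: u; rewrite -(map_unitmx (real_complex R)) -/(complexmx _).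
  rewrite rden_complex // unitmxZ; last by rewrite unitfE fmorph_eq0 sqrf_eq0.
  by rewrite unitmx_mul => /andP[h _]; rewrite -opprB -scaleN1r unitmxZ ?unitrN1.
have hx : ((0 +i* (s / c))%:M - complexmx (Acl G K)) *m toC x =
    complexmx (Bcl G K) *m toC w.
  rewrite mulmxBl mul_scalar_mx -!toC_mulmx.
  have -> : (0 +i* (s / c)) *: toC x = toC ((s / c) *: (x *m Jmx R)).
    by rewrite toCZ toCJ scalerA; congr (_ *: _); simpc.
  have -> : (s / c) *: (x *m Jmx R) = Acl G K *m x + Bcl G K *m w.
    by rewrite mulrC -scalerA stateP // scalerA mulVf // scale1r.
  by rewrite toCD addrAC subrr add0r.
rewrite /resp toCD !toC_mulmx /transfer mulmxDl; congr (_ + _).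
by rewrite -!mulmxA -hx mulKmx.
Qed.

Lemma stateZ K c s r w : state K c s (r *: w) = r *: state K c s w.
Proof. by rewrite /state rsolZ -scalemxAr scalerA mulrC -scalerA. Qed.

Lemma respZ K c s r w : resp K c s (r *: w) = r *: resp K c s w.
Proof. by rewrite /resp stateZ scalerDr !scalemxAr. Qed.

(** An exact mean value formula: the difference is bilinear in the costate of one
    policy and the state of the other, so difference quotients converge without
    any derivative being taken. *)
Lemma resp_diff K K' c s w z :
  rden (Acl G K) c s \in unitmx -> rden (Acl G K') c s \in unitmx ->
  fro z (resp K' c s w) - fro z (resp K c s w) =
  fro (inB^T *m (c *: costate K c s z) + perfD^T *m z)
    ((K' - K) *m (outC *m state K' c s w + distD *m w)).
Proof.
move=> u u'; have := costateP z u.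
have := stateP w u'; have := stateP w u; rewrite /resp.
move: (state K c s w) (state K' c s w) (costate K c s z) => x x' l hx hx' hl.
rewrite froDl !fro_mulmxl !trmxK.
apply: (response_diff hx hx' hl).
  by rewrite !AclE !BclE !mulmxDl !mulmxDr !mulNmx !mulmxN !mulmxA; mxlin.
by rewrite !CclE !DclE !mulmxDl !mulmxDr !mulNmx !mulmxN !mulmxA; mxlin.
Qed.

End ClosedLoopResponse.

(** * The cost as a supremum of gains *)

Section HinfCost.
Variables (R : realType) (n m p : nat) (G : plant R n m p).
Implicit Types K : 'M[R]_(m + n, p + n).

(** A test (c, s, w, z): the frequency is s/c, infinite when c = 0, and the
    response to the disturbance w is paired with z. Tests of norm at most 1 form
    a compact set, and the cost is the supremum of the gains over those of
    finite frequency. *)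
Definition test := (R * R * ('M[R]_(n + p, 2) * 'M[R]_(n + m, 2)))%type.
Implicit Types u : test.

Definition tests : set test := [set u |
  [/\ u.1.1 ^+ 2 + u.1.2 ^+ 2 = 1, fro u.2.1 u.2.1 <= 1 & fro u.2.2 u.2.2 <= 1]].

Definition gain K u : R := fro u.2.2 (resp G K u.1.1 u.1.2 u.2.1).

(** The gradient of the gain with respect to the policy is the product of senseL
    with the transpose of senseR, that is, of the adjoint signal at the actuator
    and controller state with the measurement and controller state. *)
Definition senseL K u : 'M[R]_(m + n, 2) :=
  (inB G)^T *m (u.1.1 *: costate G K u.1.1 u.1.2 u.2.2) + (perfD G)^T *m u.2.2.

Definition senseR K u : 'M[R]_(p + n, 2) :=
  outC G *m state G K u.1.1 u.1.2 u.2.1 + distD G *m u.2.1.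

Definition sense K K' u (v : 'M[R]_(m + n, p + n)) : R :=
  fro (senseL K u) (v *m senseR K' u).

Lemma gain_diff K K' u : rden (Acl G K) u.1.1 u.1.2 \in unitmx ->
  rden (Acl G K') u.1.1 u.1.2 \in unitmx ->
  gain K' u - gain K u = sense K K' u (K' - K).
Proof. exact: resp_diff. Qed.

Section Continuity.
Context (T : Type) (F : set_system T) {FF : Filter F}.

Lemma cvg_fro a b (f g : T -> 'M[R]_(a, b)) f0 g0 :
  f @ F --> f0 -> g @ F --> g0 -> fro (f t) (g t) @[t --> F] --> fro f0 g0.
Proof.
by move=> hf hg; apply: cvg_mxtrace; apply: cvg_mulmx => //; exact: cvg_trmx.
Qed.

Lemma cvg_lft a b d e (A : 'M[R]_(a, b)) (B : 'M[R]_(a, d)) (C : 'M[R]_(e, b))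
    (k : T -> 'M[R]_(d, e)) k0 :
  k @ F --> k0 -> A + B *m k t *m C @[t --> F] --> A + B *m k0 *m C.
Proof.
move=> hk; apply: cvg_addmx; first exact: cvg_cst.
by apply: cvg_mulmx; [apply: cvg_mulmx => //|]; exact: cvg_cst.
Qed.

Variables (k : T -> 'M[R]_(m + n, p + n)) (th : T -> test).
Variables (K0 : 'M[R]_(m + n, p + n)) (u0 : test).
Hypotheses (hk : k @ F --> K0) (hth : th @ F --> u0).

Lemma cvg_Acl : Acl G (k t) @[t --> F] --> Acl G K0.
Proof. by rewrite AclE; under eq_fun do rewrite AclE; exact: cvg_lft. Qed.

Lemma cvg_Bcl : Bcl G (k t) @[t --> F] --> Bcl G K0.
Proof. by rewrite BclE; under eq_fun do rewrite BclE; exact: cvg_lft. Qed.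

Lemma cvg_Ccl : Ccl G (k t) @[t --> F] --> Ccl G K0.
Proof. by rewrite CclE; under eq_fun do rewrite CclE; exact: cvg_lft. Qed.

Lemma cvg_Dcl : Dcl G (k t) @[t --> F] --> Dcl G K0.
Proof.
rewrite DclE -[perfD G *m _ *m _]add0r.
by under eq_fun do rewrite DclE -[perfD G *m _ *m _]add0r; exact: cvg_lft.
Qed.

Let hc : (th t).1.1 @[t --> F] --> u0.1.1.
Proof. exact: (cvg_comp _ _ (cvg_comp _ _ hth cvg_fst) cvg_fst). Qed.

Let hs : (th t).1.2 @[t --> F] --> u0.1.2.
Proof. exact: (cvg_comp _ _ (cvg_comp _ _ hth cvg_fst) cvg_snd). Qed.

Let hw : (th t).2.1 @[t --> F] --> u0.2.1.
Proof. exact: (cvg_comp _ _ (cvg_comp _ _ hth cvg_snd) cvg_fst). Qed.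

Let hz : (th t).2.2 @[t --> F] --> u0.2.2.
Proof. exact: (cvg_comp _ _ (cvg_comp _ _ hth cvg_snd) cvg_snd). Qed.

Lemma cvg_constraints :
  [/\ (th t).1.1 ^+ 2 + (th t).1.2 ^+ 2 @[t --> F] --> u0.1.1 ^+ 2 + u0.1.2 ^+ 2,
      fro (th t).2.1 (th t).2.1 @[t --> F] --> fro u0.2.1 u0.2.1 &
      fro (th t).2.2 (th t).2.2 @[t --> F] --> fro u0.2.2 u0.2.2].
Proof.
split; [|exact: cvg_fro|exact: cvg_fro].
rewrite !expr2; under eq_fun do rewrite !expr2.
by apply: cvgD; exact: cvgM.
Qed.

Hypothesis hu : rden (Acl G K0) u0.1.1 u0.1.2 \in unitmx.

Lemma near_rden_unit :
  \forall t \near F, rden (Acl G (k t)) (th t).1.1 (th t).1.2 \in unitmx.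
Proof.
have h0 : \det (rden (Acl G K0) u0.1.1 u0.1.2) != 0.
  by rewrite -unitfE -unitmxE.
have hd : \det (rden (Acl G (k t)) (th t).1.1 (th t).1.2) @[t --> F] -->
    \det (rden (Acl G K0) u0.1.1 u0.1.2).
  by apply: cvg_det; apply: cvg_rden => //; exact: cvg_Acl.
have : \forall t \near F, \det (rden (Acl G (k t)) (th t).1.1 (th t).1.2) != 0.
  exact: (hd _ (open_nbhs_nbhs (conj (@open_neq R 0) h0))).
by apply: filterS => t; rewrite unitmxE unitfE.
Qed.

Lemma cvg_state : state G (k t) (th t).1.1 (th t).1.2 (th t).2.1 @[t --> F] -->
  state G K0 u0.1.1 u0.1.2 u0.2.1.
Proof.
apply: cvg_rsol => //; first exact: cvg_Acl.
by apply: cvg_scalemx => //; apply: cvg_mulmx => //; exact: cvg_Bcl.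
Qed.

Lemma cvg_costate :
  costate G (k t) (th t).1.1 (th t).1.2 (th t).2.2 @[t --> F] -->
  costate G K0 u0.1.1 u0.1.2 u0.2.2.
Proof.
apply: cvg_rsol => //.
- by rewrite trmx_rden unitmx_tr.
- by apply: cvg_trmx; exact: cvg_Acl.
- exact: cvgN.
- by apply: cvg_mulmx => //; apply: cvg_trmx; exact: cvg_Ccl.
Qed.

Lemma cvg_gain : gain (k t) (th t) @[t --> F] --> gain K0 u0.
Proof.
apply: cvg_fro => //; apply: cvg_addmx; apply: cvg_mulmx => //.
- exact: cvg_Ccl.
- exact: cvg_state.
- exact: cvg_Dcl.
Qed.

Lemma cvg_senseL : senseL (k t) (th t) @[t --> F] --> senseL K0 u0.
Proof.
apply: cvg_addmx; apply: cvg_mulmx => //; first exact: cvg_cst.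
  by apply: cvg_scalemx => //; exact: cvg_costate.
exact: cvg_cst.
Qed.

Lemma cvg_senseR : senseR (k t) (th t) @[t --> F] --> senseR K0 u0.
Proof.
apply: cvg_addmx; apply: cvg_mulmx => //; first exact: cvg_cst.
  exact: cvg_state.
exact: cvg_cst.
Qed.

End Continuity.

Lemma test_nbhsT u : (fun x : test => x) @ nbhs u --> u.
Proof. exact: cvg_id. Qed.

Lemma compact_tests : compact tests.
Proof.
pose I := `[(-1 : R), 1]%classic.
have cI : compact I by exact: segment_compact.
have cbox : compact ((I `*` I) `*`
   ([set w : 'M[R]_(n + p, 2) | forall i j, I (w i j)] `*`
    [set z : 'M[R]_(n + m, 2) | forall i j, I (z i j)])).
  by apply: compact_setX; apply: compact_setX => //; exact: compact_mx_box.
have I1 (x : R) : x ^+ 2 <= 1 -> I x.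
  by rewrite /I /= in_itv /= => x1; apply/andP; split; nra.
rewrite (_ : tests = ((I `*` I) `*`
   ([set w : 'M[R]_(n + p, 2) | forall i j, I (w i j)] `*`
    [set z : 'M[R]_(n + m, 2) | forall i j, I (z i j)])) `&` tests).
  apply: compact_setI_closed_in => // u _ hu.
  have [h1 h2 h3] := cvg_constraints (@test_nbhsT u).
  have [c1|/eqP c1] := eqVneq (u.1.1 ^+ 2 + u.1.2 ^+ 2) 1; last first.
    have : \forall y \near u, (y : test).1.1 ^+ 2 + y.1.2 ^+ 2 != 1.
      by apply: (h1 _ (open_nbhs_nbhs (conj (@open_neq R 1) _))); apply/eqP.
    by apply: filterS => y /eqP hy [].
  have [c2|c2] := lerP (fro u.2.1 u.2.1) 1; last first.
    have : \forall y \near u, 1 < fro (y : test).2.1 y.2.1.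
      exact: (h2 _ (lt_nbhsr c2)).
    by apply: filterS => y hy [_]; rewrite leNgt hy.
  have [c3|c3] := lerP (fro u.2.2 u.2.2) 1; last first.
    have : \forall y \near u, 1 < fro (y : test).2.2 y.2.2.
      exact: (h3 _ (lt_nbhsr c3)).
    by apply: filterS => y hy [_ _]; rewrite leNgt hy.
  by case: hu.
rewrite setIidr // => -[[c s] [w z]] [/= cs ww zz].
split; split => /=.
- by apply: I1; rewrite -cs lerDl sqr_ge0.
- by apply: I1; rewrite -cs lerDr sqr_ge0.
- by move=> i j; apply: I1; exact: le_trans (sqr_entry_le_fro _ _ _) ww.
- by move=> i j; apply: I1; exact: le_trans (sqr_entry_le_fro _ _ _) zz.
Qed.

Lemma tests_nonempty : tests !=set0.
Proof. by exists (1, 0, (0, 0)); split; rewrite /= ?fro0l ?ler01 // expr1n expr0n addr0. Qed.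

Lemma near_regular K : regular G K -> \forall K' \near K, regular G K'.
Proof.
move=> hK; have /compact_near_coveringP covering := compact_tests.
have := covering _ (nbhs K)
  (fun K' u => rden (Acl G K') u.1.1 u.1.2 \in unitmx) (nbhs_filter K).
have h u : tests u -> \forall u' \near u & K' \near K,
    rden (Acl G K') (u' : test).1.1 u'.1.2 \in unitmx.
  move=> [cs _ _].
  apply: (@near_rden_unit _ (filter_prod (nbhs u) (nbhs K)) _ snd fst K u).
  - exact: cvg_snd.
  - exact: cvg_fst.
  - exact: hK.
move=> /(_ h); apply: filterS => K' hK' c s cs.
by apply: (hK' (c, s, (0, 0))); split; rewrite /= ?fro0l ?ler01.
Qed.

Lemma gain_continuous K u : regular G K -> tests u ->
  gain K u' @[u' --> u] --> gain K u.
Proof.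
move=> hK [cs _ _].
by apply: cvg_gain; [exact: cvg_cst|exact: test_nbhsT|exact: hK].
Qed.

Lemma gain_bounded K : regular G K -> exists M, forall u, tests u -> gain K u <= M.
Proof.
move=> hK; have [|u _ umax] := compact_EVT_max tests_nonempty compact_tests
  (f := gain K).
  apply: continuous_in_subspaceT => u; rewrite inE => hu.
  exact: gain_continuous.
by exists (gain K u) => u' hu'; apply: umax; rewrite inE.
Qed.

Hypothesis np_gt0 : (0 < n + p)%N.

Lemma toC_resp_freq K c s (hK : regular G K) (cs : c ^+ 2 + s ^+ 2 = 1)
    (c0 : c != 0) w :
  toC (resp G K c s w) = transfer G K (s / c) *m toC w.
Proof. by apply: toC_resp => //; exact: hK. Qed.

Lemma freq_test (w : R) : exists c s : R,
  [/\ c ^+ 2 + s ^+ 2 = 1, c != 0 & s / c = w].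
Proof.
have w1 : 0 < 1 + w ^+ 2 by rewrite ltr_pwDl // sqr_ge0.
have c0 : Num.sqrt (1 + w ^+ 2) != 0 by rewrite gt_eqF // sqrtr_gt0.
exists (Num.sqrt (1 + w ^+ 2))^-1, (w / Num.sqrt (1 + w ^+ 2)); split.
- rewrite expr_div_n exprVn sqr_sqrtr ?ltW // -[X in X + _]mul1r -mulrDl.
  by rewrite divff // gt_eqF.
- by rewrite invr_eq0.
- by rewrite invrK divfK.
Qed.

Lemma sigma_max_gain K w : regular G K -> exists u,
  [/\ tests u, u.1.1 != 0, u.1.2 / u.1.1 = w &
      gain K u = sigma_max (transfer G K w)].
Proof.
move=> hK; have [c [s [cs c0 sc]]] := freq_test w.
have hf X : toC (resp G K c s X) = transfer G K w *m toC X.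
  by rewrite -sc; exact: toC_resp_freq.
have [X [Z [X1 Z1 XZ]]] := sigma_max_attained hf np_gt0.
by exists (c, s, (X, Z)).
Qed.

Lemma has_sup_sigma_max K : regular G K ->
  has_sup (range (fun w => sigma_max (transfer G K w))).
Proof.
move=> hK; split; first by exists (sigma_max (transfer G K 0)), 0.
have [M hM] := gain_bounded hK; exists M => _ [w _ <-].
by have [u [hu _ _ <-]] := sigma_max_gain w hK; exact: hM.
Qed.

(** At a finite frequency, which is where the cost is defined. *)
Lemma gain_le_Hinf K u : regular G K -> tests u -> u.1.1 != 0 ->
  gain K u <= Hinf_cost G K.
Proof.
case: u => [[c s] [w z]] hK [/= cs ww zz] c0.
apply: (@le_trans _ _ (sigma_max (transfer G K (s / c)))); last first.
  by apply: sup_upper_bound; [exact: has_sup_sigma_max|exists (s / c)].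
by apply: fro_le_sigma_max => // X; exact: toC_resp_freq.
Qed.

Lemma Hinf_approx K e : regular G K -> 0 < e -> exists u,
  [/\ tests u, u.1.1 != 0 & Hinf_cost G K - e < gain K u].
Proof.
move=> hK e0; have [_ [w _ <-] hw] := sup_adherent e0 (has_sup_sigma_max hK).
by have [u [hu u0 _ hg]] := sigma_max_gain w hK; exists u; split; rewrite ?hg.
Qed.

Lemma Hinf_ge0 K : 0 <= Hinf_cost G K.
Proof. by apply: sup_of_ge0 => _ [w _ <-]; exact: sigma_max_ge0. Qed.

End HinfCost.

(** * Active tests from Clarke stationarity *)

Lemma descent_estimate (R : realType) (g e t d a a' b b' S : R) :
  0 < t -> d <= e / 2 -> d <= t * (e / 2) -> a' - d < b' -> b <= a ->
  g - e / 2 < a' -> b' < g - e \/ S < - e -> b' - b = t * S ->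
  a' - a <= - (e / 2) * t.
Proof.
move=> t0 d1 d2 h1 h2 h3 [h4|h4] h5; first by lra.
have : t * S <= t * - e by rewrite ler_wpM2l // ltW.
by lra.
Qed.

Section ClarkeDescent.
Variables (R : realType) (n m p : nat) (G : plant R n m p).
Hypothesis np_gt0 : (0 < n + p)%N.
Implicit Types K v : 'M[R]_(m + n, p + n).

(** The cost is lower semicontinuous, as a supremum of continuous functions. *)
Lemma near_Hinf_gt K e : regular G K -> 0 < e ->
  \forall K' \near K, Hinf_cost G K - e < Hinf_cost G K'.
Proof.
move=> hK e0; have [u [hu u0 hg]] := Hinf_approx np_gt0 hK e0.
have [cs _ _] := hu.
have hc : gain G K' u @[K' --> K] --> gain G K u.
  apply: (@cvg_gain _ _ _ _ G _ (nbhs K) _ id (cst u) K u).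
  - exact: cvg_id.
  - exact: cvg_cst.
  - exact: hK.
have h1 : \forall K' \near K, Hinf_cost G K - e < gain G K' u.
  exact: (hc _ (lt_nbhsr hg)).
have h2 := near_regular hK.
apply: filterS2 h1 h2 => K' h1 h2; apply: lt_le_trans h1 _.
exact: gain_le_Hinf.
Qed.

Lemma clarke_dd_le K v e :
  (\forall Yt \near filter_prod (nbhs K) (at_right (0 : R)),
     (Hinf_cost G (Yt.1 + Yt.2 *: v) - Hinf_cost G Yt.1) / Yt.2 <= e) ->
  (clarke_dd (Hinf_cost G) K v <= e%:E)%E.
Proof.
set f := fun Yt => _ => h.
pose V := [set Yt | f Yt].
apply: (@le_trans _ _ (ereal_sup ((fun yt : 'M[R]_(m + n, p + n) * R =>
   ((Hinf_cost G (yt.1 + yt.2 *: v) - Hinf_cost G yt.1) / yt.2)%:E) @` V))).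
  by apply: ereal_inf_lbound; exists V.
by apply: ge_ereal_sup => _ [Yt hYt <-]; rewrite lee_fin.
Qed.

(** Otherwise every test is either inactive or has negative slope along v. By
    compactness this holds with a uniform margin e for all policies near K, and
    the test that nearly attains the cost at Y + tv shows that the cost drops by
    at least te/2 from Y to Y + tv: the Clarke derivative is negative. *)
Lemma clarke_active K v : regular G K -> clarke_subdiff (Hinf_cost G) K 0 ->
  exists u, [/\ tests u, Hinf_cost G K <= gain G K u & 0 <= sense G K K u v].
Proof.
move=> hK hstat; apply: contrapT => hn.
set g := Hinf_cost G K in hn.
pose F1 := filter_prod (nbhs K) (at_right (0 : R)).
have FF1 : Filter F1 by exact: filter_prod_filter.
pose F := filter_prod F1 (at_right (0 : R)).
have FF2 : Filter F by exact: filter_prod_filter.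
(* i = (Y, t, e): base policy, step, margin *)
pose P (i : ('M[R]_(m + n, p + n) * R) * R) (u : test R n m p) :=
  gain G (i.1.1 + i.1.2 *: v) u < g - i.2 \/
  sense G i.1.1 (i.1.1 + i.1.2 *: v) u v < - i.2.
have /compact_near_coveringP covering := @compact_tests R n m p.
have hcov : forall u, tests u -> \forall u' \near u & i \near F, P i u'.
  move=> u hu; have [cs _ _] := hu; have hKu := hK _ _ cs.
  pose FF := filter_prod (nbhs u) F.
  have FF3 : Filter FF by exact: filter_prod_filter.
  have cu : (x : test R n m p * (('M[R]_(m + n, p + n) * R) * R)).1 @[x --> FF] --> u.
    exact: cvg_fst.
  have ci : x.2 @[x --> FF] --> F by exact: cvg_snd.
  have cY : x.2.1.1 @[x --> FF] --> K.
    exact: (cvg_comp _ _ (cvg_comp _ _ ci cvg_fst) cvg_fst).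
  have a0 : (x : R) @[x --> at_right 0] --> (0 : R).
    by apply: cvg_at_right_filter; exact: cvg_id.
  have ct : x.2.1.2 @[x --> FF] --> (0 : R).
    exact: (cvg_comp _ _ (cvg_comp _ _ (cvg_comp _ _ ci cvg_fst) cvg_snd) a0).
  have ce : x.2.2 @[x --> FF] --> (0 : R).
    exact: (cvg_comp _ _ (cvg_comp _ _ ci cvg_snd) a0).
  have cY' : x.2.1.1 + x.2.1.2 *: v @[x --> FF] --> K.
    rewrite -[K in _ --> K]addr0 -(scale0r v).
    by apply: cvg_addmx => //; apply: cvg_scalemx => //; exact: cvg_cst.
  have [hlt|hge] := ltrP (gain G K u) g.
    have cg : gain G (x.2.1.1 + x.2.1.2 *: v) x.1 + x.2.2 @[x --> FF] -->
        gain G K u + 0 by apply: cvgD => //; exact: cvg_gain.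
    have : \forall x \near FF, gain G (x.2.1.1 + x.2.1.2 *: v) x.1 + x.2.2 < g.
      by apply: (cg _ (lt_nbhsl _)); rewrite addr0.
    by apply: (@filterS _ FF) => x hx; left; rewrite ltrBrDr; exact: hx.
  have hs : sense G K K u v < 0.
    by rewrite ltNge; apply/negP => hs; apply: hn; exists u.
  have cs' : sense G x.2.1.1 (x.2.1.1 + x.2.1.2 *: v) x.1 v + x.2.2
      @[x --> FF] --> sense G K K u v + 0.
    apply: cvgD => //; apply: cvg_fro; first exact: cvg_senseL.
    by apply: cvg_mulmx; [exact: cvg_cst|exact: cvg_senseR].
  have : \forall x \near FF,
      sense G x.2.1.1 (x.2.1.1 + x.2.1.2 *: v) x.1 v + x.2.2 < 0.
    by apply: (cs' _ (lt_nbhsl _)); rewrite addr0.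
  by apply: (@filterS _ FF) => x hx; right; rewrite -subr_lt0 opprK; exact: hx.
have [[A B] [/= hA hB] hAB] := covering _ F P _ hcov.
have [e [Be e0]] : exists e, B e /\ 0 < e.
  have : \forall e \near at_right (0 : R), B e /\ 0 < e.
    by apply: filterI => //; exact: nbhs_right_gt.
  by move/filter_ex.
have hUn : \forall Yt \near F1, [/\ regular G Yt.1, regular G (Yt.1 + Yt.2 *: v),
    0 < Yt.2 & g - e / 2 < Hinf_cost G (Yt.1 + Yt.2 *: v)].
  have cY : Yt.1 @[Yt --> F1] --> K by exact: cvg_fst.
  have ct : Yt.2 @[Yt --> F1] --> (0 : R).
    exact: (cvg_comp _ _ cvg_snd (cvg_at_right_filter (@cvg_id _ (nbhs (0 : R))))).
  have cY' : Yt.1 + Yt.2 *: v @[Yt --> F1] --> K.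
    rewrite -[K in _ --> K]addr0 -(scale0r v).
    by apply: cvg_addmx => //; apply: cvg_scalemx => //; exact: cvg_cst.
  have n1 : \forall Yt \near F1, regular G Yt.1 by exact: (cY _ (near_regular hK)).
  have n2 : \forall Yt \near F1, regular G (Yt.1 + Yt.2 *: v).
    exact: (cY' _ (near_regular hK)).
  have n3 : \forall Yt \near F1, 0 < Yt.2.
    exists (setT, [set t : R | 0 < t]); last by case=> ? ? [].
    by split; [exact: filterT|exact: nbhs_right_gt].
  have e2 : 0 < e / 2 by rewrite divr_gt0.
  have n4 : \forall Yt \near F1, g - e / 2 < Hinf_cost G (Yt.1 + Yt.2 *: v).
    exact: (cY' _ (near_Hinf_gt hK e2)).
  have hI := @filterI _ F1 FF1 _ _ (@filterI _ F1 FF1 _ _ n1 n2)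
    (@filterI _ F1 FF1 _ _ n3 n4).
  by apply: (@filterS _ F1 FF1 _ _ _ hI) => Yt [[? ?] [? ?]]; split.
have : (clarke_dd (Hinf_cost G) K v <= (- (e / 2))%:E)%E.
  apply: clarke_dd_le; have hI := @filterI _ F1 FF1 _ _ hA hUn.
  apply: (@filterS _ F1 FF1 _ _ _ hI) => Yt [AYt [r1 r2 t0 hgt]].
  rewrite ler_pdivrMr //; set Y := Yt.1; set t := Yt.2 in t0 *.
  set Y' := Y + t *: v in hgt *.
  (* a tolerance below t e / 2 loses at most half of the slope *)
  pose d := Order.min (e / 2) (t * (e / 2)).
  have d0 : 0 < d by rewrite lt_min divr_gt0 //= mulr_gt0 // divr_gt0.
  have d1 : d <= e / 2 by rewrite ge_min lexx.
  have d2 : d <= t * (e / 2) by rewrite ge_min lexx orbT.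
  have [u [hu u0 hgu]] := Hinf_approx np_gt0 r2 d0.
  have hP : gain G Y' u < g - e \/ sense G Y Y' u v < - e.
    exact: (hAB (Yt, e) (conj AYt Be) u hu).
  have [cs _ _] := hu.
  have hY := gain_le_Hinf np_gt0 r1 hu u0.
  apply: (descent_estimate t0 d1 d2 hgu hY hgt hP).
  rewrite -(_ : sense G Y Y' u (Y' - Y) = t * sense G Y Y' u v).
    exact: gain_diff (r1 _ _ cs) (r2 _ _ cs).
  have -> : Y' - Y = t *: v by rewrite /Y' addrAC subrr add0r.
  by rewrite /sense -scalemxAl froZr.
have := hstat v; rewrite trmx0 mul0mx mxtrace0 => h1 h2.
have := le_trans h1 h2; rewrite lee_fin; apply/negP; rewrite -ltNge.
by rewrite oppr_lt0 divr_gt0.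
Qed.

End ClarkeDescent.

(** * The matrix inequality at active tests *)

Section Semidefinite.
Variables (R : realType) (N : nat).

Lemma psdmx_sym (M : 'M[R]_N) : M \is symmetricmx -> M^T = M.
Proof.
move=> h; have := is_hermitianmxP _ _ _ h.
by rewrite expr0 scale1r map_mx_id // => <-.
Qed.

Variables (k : nat) (M : 'M[R]_N).
Implicit Types V W : 'M[R]_(N, k).

Lemma psdmx_fro_ge0 V : psdmx M -> 0 <= fro V (M *m V).
Proof.
move=> [_ h]; rewrite /fro /mxtrace; apply: sumr_ge0 => j _.
have := h (col j V); rewrite colE; set D := delta_mx j _.
have -> : (V^T *m (M *m V)) j j = (D^T *m (V^T *m (M *m V)) *m D) 0 0.
  by rewrite -colE trmx_delta -rowE !mxE.
by rewrite trmx_mul !mulmxA.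
Qed.

(** A zero of a nonnegative quadratic form is a minimum, so the derivative
    vanishes there. *)
Lemma psdmx_fro_eq0 V : psdmx M -> fro V (M *m V) = 0 -> M *m V = 0.
Proof.
move=> hM h0; have MT := psdmx_sym (proj1 hM).
set Y := M *m V; set q := fro Y (M *m Y).
have q0 : 0 <= q by exact: psdmx_fro_ge0.
apply: fro_eq0; apply/eqP; rewrite eq_le fro_ge0 andbT leNgt; apply/negP => Y0.
pose t := - (fro Y Y / (q + 1)).
have q1 : 0 < q + 1 by rewrite ltr_wpDl.
have := psdmx_fro_ge0 (V + t *: Y) hM.
rewrite mulmxDr -scalemxAr !froDr !froDl !froZr !froZl -/Y h0 -/q.
have -> : fro V (M *m Y) = fro Y Y by rewrite fro_mulmxr MT.
have -> : 0 + t * fro Y Y + (t * fro Y Y + t * (t * q)) =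
   - (fro Y Y ^+ 2 / (q + 1) * (2 - q / (q + 1))).
  by rewrite /t; field; rewrite gt_eqF.
rewrite oppr_ge0 leNgt => /negP; apply; apply: mulr_gt0.
  by rewrite divr_gt0 // exprn_gt0.
by rewrite subr_gt0 ltr_pdivrMr //; lra.
Qed.

End Semidefinite.

Section BoundedReal.
Variables (R : realType) (n m p : nat) (G : plant R n m p).
Variables (K : 'M[R]_(m + n, p + n)) (g : R) (P : 'M[R]_(n + n)).
Hypotheses (hP : pdmx P) (hL : nsdmx (brl_mx G g K P)).

Lemma brl_mul (x : 'M[R]_(n + n, 2)) w z :
  brl_mx G g K P *m col_mx (col_mx x w) z = col_mx (col_mx
    ((Acl G K)^T *m (P *m x) + P *m (Acl G K *m x + Bcl G K *m w) + (Ccl G K)^T *m z)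
    ((Bcl G K)^T *m (P *m x) - g *: w + (Dcl G K)^T *m z))
    (Ccl G K *m x + Dcl G K *m w - g *: z).
Proof.
rewrite /brl_mx mul_block_col mul_block_col mul_col_mx add_col_mx.
rewrite !mulNmx !mul_scalar_mx mul_row_col; congr (col_mx (col_mx _ _) _).
by rewrite mulmxDl mulmxDr !mulmxA addrA.
by rewrite !mulmxA.
Qed.

(** Along a solution of the state equation the storage term drops out, since
    multiplication by the imaginary unit is skew and P is symmetric. *)
Lemma storage_eq0 (x y : 'M[R]_(n + n, 2)) (c s : R) :
  c ^+ 2 + s ^+ 2 = 1 -> s *: (x *m Jmx R) = c *: y -> fro x (P *m y) = 0.
Proof.
move=> cs e; have PT := psdmx_sym (proj1 hP).
have [c0|c0] := eqVneq c 0.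
  by rewrite (infinite_freq_eq0 cs e c0) fro0l.
rewrite -(finite_freq c0 e).
rewrite -scalemxAr froZr fro_mulmxr PT.
have : fro (P *m x *m Jmx R) x = fro (P *m x) (x *m Jmx R).
  by rewrite -mulmxA fro_mulmxl PT froC.
rewrite fro_J; set r := fro _ _ => h.
by have -> : r = 0; [lra|rewrite mulr0].
Qed.

(** Without its storage term the quadratic form of the matrix inequality at
    (x, w, z) is 2 gain - g (|w|^2 + |z|^2). It is nonpositive by the
    inequality and nonnegative at an active test, so it is 0: the test lies in
    the kernel, and w and z have norm 1. *)
Lemma brl_kernel u : 0 < g -> rden (Acl G K) u.1.1 u.1.2 \in unitmx ->
  tests u -> g <= gain G K u ->
  let x := state G K u.1.1 u.1.2 u.2.1 in let w := u.2.1 in let z := u.2.2 in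
  [/\ (Acl G K)^T *m (P *m x) + P *m (Acl G K *m x + Bcl G K *m w)
        + (Ccl G K)^T *m z = 0,
      (Bcl G K)^T *m (P *m x) + (Dcl G K)^T *m z = g *: w,
      Ccl G K *m x + Dcl G K *m w = g *: z,
      fro w w = 1 & fro z z = 1].
Proof.
case: u => [[c s] [w z]] g0 hu [/= cs ww zz].
have := stateP w hu; rewrite /gain /resp /=.
move: (state G K c s w) => x hx hg.
have PT := psdmx_sym (proj1 hP).
pose V := col_mx (col_mx x w) z.
have hq : fro V (brl_mx G g K P *m V) =
    2 * fro z (Ccl G K *m x + Dcl G K *m w) - g * (fro w w + fro z z).
  rewrite brl_mul !fro_col.
  have e1 : fro x ((Acl G K)^T *m (P *m x)) = fro x (P *m (Acl G K *m x)).
    by rewrite fro_mulmxr trmxK froC fro_mulmxl PT.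
  have e2 : fro w ((Bcl G K)^T *m (P *m x)) = fro x (P *m (Bcl G K *m w)).
    by rewrite fro_mulmxr trmxK froC fro_mulmxl PT.
  have e3 : fro x ((Ccl G K)^T *m z) = fro z (Ccl G K *m x).
    by rewrite fro_mulmxr trmxK froC.
  have e4 : fro w ((Dcl G K)^T *m z) = fro z (Dcl G K *m w).
    by rewrite fro_mulmxr trmxK froC.
  have := storage_eq0 cs hx.
  rewrite mulmxDr !froDr !froNr !froZr e1 e2 e3 e4.
  move: (fro x _) (fro x _) (fro z _) (fro z _) (fro w _) (fro z _).
  by move=> *; lra.
have q0 : fro V (brl_mx G g K P *m V) <= 0.
  by have := psdmx_fro_ge0 V hL; rewrite mulNmx froNr oppr_ge0.
move: hg hq ww zz q0; set r := fro z _; set f := fro V _.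
move: (fro w w) (fro z z) => a b hg hq ww zz q0.
have f0 : f = 0 by nra.
have a1 : a = 1 by nra.
have b1 : b = 1 by nra.
have : brl_mx G g K P *m V = 0.
  apply: oppr_inj; rewrite -mulNmx oppr0; apply: (psdmx_fro_eq0 hL).
  by rewrite mulNmx froNr -/f f0 oppr0.
rewrite brl_mul => /eqP; rewrite !col_mx_eq0.
move=> /andP[/andP[/eqP k1 /eqP k2] /eqP k3].
split=> //.
- by apply/eqP; rewrite -subr_eq0 addrAC k2.
- by apply/eqP; rewrite -subr_eq0 k3.
Qed.

(** The first kernel equation says that P x solves the adjoint equation, so at an
    active test the costate, scaled by c, is P times the state. *)
Lemma senseL_active u : 0 < g -> rden (Acl G K) u.1.1 u.1.2 \in unitmx ->
  tests u -> g <= gain G K u ->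
  senseL G K u =
  (inB G)^T *m (P *m state G K u.1.1 u.1.2 u.2.1) + (perfD G)^T *m u.2.2.
Proof.
move=> g0 hu ht hg; have [k1 _ _ _ _] := brl_kernel g0 hu ht hg.
have hx := stateP u.2.1 hu.
rewrite /senseL; congr (_ *m _ + _).
have hut : rden (Acl G K)^T u.1.1 (- u.1.2) \in unitmx.
  by rewrite trmx_rden unitmx_tr.
rewrite /costate; move: (state G K _ _ _) hx k1 => x hx k1.
move: (u.2.2) k1 => z k1.
rewrite rsolZ; symmetry; apply: rsol_uniq => //.
have -> : (Ccl G K)^T *m z = - ((Acl G K)^T *m (P *m x) +
    P *m (Acl G K *m x + Bcl G K *m u.2.1)).
  by apply/eqP; rewrite -addr_eq0 addrC k1.
rewrite scalerN scalerDr (scalemxAr u.1.1 P) -hx -mulmxA -scalemxAr.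
by mxlin.
Qed.

End BoundedReal.

(** * Covariances and a Sylvester equation *)

Section Covariance.
Variables (R : realType) (I : finType).

(** The real part of the sum over i of x_i times the adjoint of y_i. *)
Definition cov a b (X : I -> 'M[R]_(a, 2)) (Y : I -> 'M[R]_(b, 2)) : 'M[R]_(a, b) :=
  \sum_i X i *m (Y i)^T.

Lemma eq_cov a b (X X' : I -> 'M[R]_(a, 2)) (Y Y' : I -> 'M[R]_(b, 2)) :
  X =1 X' -> Y =1 Y' -> cov X Y = cov X' Y'.
Proof. by move=> hX hY; apply: eq_bigr => i _; rewrite hX hY. Qed.

Lemma cov_mull a b c (A : 'M[R]_(c, a)) (X : I -> 'M[R]_(a, 2))
    (Y : I -> 'M[R]_(b, 2)) : cov (fun i => A *m X i) Y = A *m cov X Y.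
Proof. by rewrite /cov mulmx_sumr; apply: eq_bigr => i _; rewrite mulmxA. Qed.

Lemma cov_mulr a b c (A : 'M[R]_(c, b)) (X : I -> 'M[R]_(a, 2))
    (Y : I -> 'M[R]_(b, 2)) : cov X (fun i => A *m Y i) = cov X Y *m A^T.
Proof.
by rewrite /cov mulmx_suml; apply: eq_bigr => i _; rewrite trmx_mul mulmxA.
Qed.

Lemma covDl a b (X X' : I -> 'M[R]_(a, 2)) (Y : I -> 'M[R]_(b, 2)) :
  cov (fun i => X i + X' i) Y = cov X Y + cov X' Y.
Proof. by rewrite /cov -big_split; apply: eq_bigr => i _; rewrite mulmxDl. Qed.

Lemma covDr a b (X : I -> 'M[R]_(a, 2)) (Y Y' : I -> 'M[R]_(b, 2)) :
  cov X (fun i => Y i + Y' i) = cov X Y + cov X Y'.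
Proof.
by rewrite /cov -big_split; apply: eq_bigr => i _; rewrite linearD mulmxDr.
Qed.

Lemma cov_J a b (r : I -> R) (X : I -> 'M[R]_(a, 2)) (Y : I -> 'M[R]_(b, 2)) :
  cov (fun i => r i *: (X i *m Jmx R)) Y =
  - cov X (fun i => r i *: (Y i *m Jmx R)).
Proof.
rewrite /cov -sumrN; apply: eq_bigr => i _.
rewrite linearZ /= trmx_mul tr_Jmx -scalemxAl -scalemxAr mulNmx mulmxN.
by rewrite scalerN opprK mulmxA.
Qed.

Lemma sum_fro_cov a (X Y : I -> 'M[R]_(a, 2)) :
  \sum_i fro (X i) (Y i) = \tr (cov X Y).
Proof.
rewrite /cov linear_sum; apply: eq_bigr => i _ /=.
by rewrite froC /fro mxtrace_mulC.
Qed.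

Lemma cov_eq0 a (X : I -> 'M[R]_(a, 2)) : cov X X = 0 -> forall i, X i = 0.
Proof.
move=> h i; apply: fro_eq0; apply/eqP.
have : \sum_i fro (X i) (X i) = 0 by rewrite sum_fro_cov h mxtrace0.
move/eqP; rewrite psumr_eq0 => [/allP /(_ i (mem_index_enum i))//|j _].
exact: fro_ge0.
Qed.

End Covariance.

Section CovarianceBlocks.
Variables (R : realType) (I : finType) (a1 a2 b1 b2 : nat).
Variables (X1 : I -> 'M[R]_(a1, 2)) (X2 : I -> 'M[R]_(a2, 2)).
Variables (Y1 : I -> 'M[R]_(b1, 2)) (Y2 : I -> 'M[R]_(b2, 2)).
Let C := cov (fun i => col_mx (X1 i) (X2 i)) (fun i => col_mx (Y1 i) (Y2 i)).

Let CE : C = \sum_i block_mx (X1 i *m (Y1 i)^T) (X1 i *m (Y2 i)^T)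
  (X2 i *m (Y1 i)^T) (X2 i *m (Y2 i)^T).
Proof. by apply: eq_bigr => i _; rewrite tr_col_mx mul_col_row. Qed.

Lemma cov_ul : ulsubmx C = cov X1 Y1.
Proof.
rewrite CE /ulsubmx !linear_sum; apply: eq_bigr => i _.
exact: block_mxKul.
Qed.

Lemma cov_ur : ursubmx C = cov X1 Y2.
Proof.
rewrite CE /ursubmx !linear_sum; apply: eq_bigr => i _.
exact: block_mxKur.
Qed.

Lemma cov_dl : dlsubmx C = cov X2 Y1.
Proof.
rewrite CE /dlsubmx !linear_sum; apply: eq_bigr => i _.
exact: block_mxKdl.
Qed.

Lemma cov_dr : drsubmx C = cov X2 Y2.
Proof.
rewrite CE /drsubmx !linear_sum; apply: eq_bigr => i _.
exact: block_mxKdr.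
Qed.

End CovarianceBlocks.

Section Sylvester.
Variables (R : realType) (I : finType).

(** The value at F of the polynomial that vanishes at jr and -jr for r in rs. *)
Fixpoint annihilator n (F : 'M[R]_n) (rs : seq R) : 'M[R]_n :=
  if rs is r :: rs' then (F *m F + (r ^+ 2)%:M) *m annihilator F rs' else 1%:M.

(** Used to bring the factor that kills a given mode to the front. *)
Lemma annihilator_comm n (F : 'M[R]_n) r rs :
  (F *m F + (r ^+ 2)%:M) *m annihilator F rs =
  annihilator F rs *m (F *m F + (r ^+ 2)%:M).
Proof.
elim: rs => [|r' rs IH] /=; first by rewrite mulmx1 mul1mx.
rewrite -mulmxA -IH !mulmxA; congr (_ *m _).
set X := F *m F; rewrite !mulmxDl !mulmxDr !(scalar_mxC _ X) -!scalar_mxM.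
by rewrite (mulrC (r ^+ 2)); mxlin.
Qed.

Lemma annihilator_eq0 n (F : 'M[R]_n) (x : 'M[R]_(n, 2)) rs r :
  r \in rs -> r *: (x *m Jmx R) = F *m x -> annihilator F rs *m x = 0.
Proof.
move=> + hx; have hq : (F *m F + (r ^+ 2)%:M) *m x = 0.
  rewrite mulmxDl -mulmxA -hx -scalemxAr mulmxA -hx -scalemxAl mulmxJJ.
  by rewrite mul_scalar_mx scalerA -expr2 scalerN addNr.
elim: rs => [//|r' rs IH]; rewrite inE => /orP[/eqP <-|hr] /=.
  by rewrite annihilator_comm -mulmxA hq mulmx0.
by rewrite -mulmxA IH // mulmx0.
Qed.

Lemma annihilator_unit n (A : 'M[R]_n) rs : hurwitzmx A ->
  annihilator A^T rs \in unitmx.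
Proof.
move=> hA; elim: rs => [|r rs IH] /=; first exact: unitmx1.
rewrite unitmx_mul IH andbT.
have r1 : 0 < 1 + r ^+ 2 by rewrite ltr_pwDl // sqr_ge0.
have [c [s [cs c0 sc]]] := freq_test r.
have := hurwitz_rden_unit hA cs.
have -> : rden A c s = c ^+ 2 *: (A *m A + (r ^+ 2)%:M).
  rewrite /rden scalerDr scale_scalar_mx -sc expr_div_n mulrC divfK //.
  by rewrite sqrf_eq0.
rewrite unitmxZ ?unitfE ?sqrf_eq0 // -unitmx_tr.
by rewrite linearD /= trmx_mul tr_scalar_mx.
Qed.

(** The e_i are modes of F on the imaginary axis, while the spectrum of -A^T lies
    in the open right half-plane: the polynomial that annihilates the former is
    invertible at the latter, and M intertwines the two. *)
Lemma sylvester_cov_eq0 n k (F : 'M[R]_n) (A : 'M[R]_k) (r : I -> R)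
    (e : I -> 'M[R]_(n, 2)) (d : I -> 'M[R]_(k, 2)) :
  hurwitzmx A -> (forall i, r i *: (e i *m Jmx R) = F *m e i) ->
  F *m cov e d = - (cov e d *m A^T) -> cov e d = 0.
Proof.
move=> hA he hM; set M := cov e d in hM *.
have hrs rs : annihilator F rs *m M = M *m annihilator A^T rs.
  elim: rs => [|r' rs IH] /=; first by rewrite mul1mx mulmx1.
  rewrite -mulmxA IH !mulmxA; congr (_ *m _).
  have hM2 : F *m F *m M = M *m (A^T *m A^T).
    by rewrite -mulmxA hM mulmxN (mulmxA F) hM mulNmx opprK mulmxA.
  by rewrite mulmxDl mulmxDr hM2 scalar_mxC.
pose rs := [seq r i | i <- enum I].
have : annihilator F rs *m M = 0.
  rewrite /M /cov mulmx_sumr big1 // => i _; rewrite mulmxA.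
  rewrite (annihilator_eq0 (r := r i)) ?mul0mx //.
  by apply: map_f; rewrite mem_enum.
rewrite hrs => h0; have := annihilator_unit rs hA => u.
by rewrite -[M](mulmxK u) h0 mul0mx.
Qed.

End Sylvester.

(** * The orthogonality argument *)

(* normal form of products over sums and differences, then entrywise equality *)
Ltac mxexpand :=
  rewrite ?(mulmxDl, mulmxDr, mulmxBl, mulmxBr, mulNmx, mulmxN, scalerDr,
    scalerN, opprD, opprK);
  rewrite -?(scalemxAl, scalemxAr) ?mulmxA; mxlin.

Section Certificate.
Variables (R : realType) (I : finType) (n m p : nat).
Variables (A : 'M[R]_n) (B : 'M[R]_(n, m)) (C : 'M[R]_(p, n)).
Variables (Q' W' : 'M[R]_n) (R' : 'M[R]_m) (V' : 'M[R]_p).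
Variables (Dk : 'M[R]_(m, p)) (Ck : 'M[R]_(m, n)) (Bk : 'M[R]_(n, p)) (Ak : 'M[R]_n).
Variables (P11 P12 P22 : 'M[R]_n) (g : R).
Variables (c s : I -> R) (xi eta : I -> 'M[R]_(n, 2)).
Variables (w1 : I -> 'M[R]_(n, 2)) (w2 : I -> 'M[R]_(p, 2)).
Variables (z1 : I -> 'M[R]_(n, 2)) (z2 : I -> 'M[R]_(m, 2)).

Let y i := C *m xi i + V' *m w2 i.
Let u i := Dk *m y i + Ck *m eta i.
Let pp i := P11 *m xi i + P12 *m eta i.
Let zeta i := P12^T *m xi i + P22 *m eta i.
Let a i := B^T *m pp i + R'^T *m z2 i.

Hypotheses (g_neq0 : g != 0) (P12u : P12 \in unitmx).
Hypothesis cs : forall i, c i ^+ 2 + s i ^+ 2 = 1.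
Hypothesis x_inf : forall i, c i = 0 -> xi i = 0 /\ eta i = 0.
Hypothesis xi_dyn : forall i, c i != 0 ->
  (s i / c i) *: (xi i *m Jmx R) = A *m xi i + B *m u i + W' *m w1 i.
Hypothesis eta_dyn : forall i, c i != 0 ->
  (s i / c i) *: (eta i *m Jmx R) = Bk *m y i + Ak *m eta i.
Hypothesis w1E : forall i, g *: w1 i = W'^T *m pp i.
Hypothesis w2E : forall i, g *: w2 i = V'^T *m (Dk^T *m a i + Bk^T *m zeta i).
Hypothesis z2E : forall i, g *: z2 i = R' *m u i.
Hypothesis z1E : forall i, c i != 0 -> Q'^T *m z1 i =
  - (A^T *m pp i + (s i / c i) *: (pp i *m Jmx R) +
     C^T *m (Dk^T *m a i + Bk^T *m zeta i)).
Hypotheses (cov_ay : cov a y = 0) (cov_aeta : cov a eta = 0).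
Hypotheses (cov_zy : cov zeta y = 0) (cov_zeta : cov zeta eta = 0).

(* With xi the plant state and eta the controller state, -S eta plays the role
   of an estimate of xi and e is the estimation error. *)
Let T := invmx P12^T.
Let S := T *m P22.
Let e i := T *m zeta i.
Let L := B^T *m P11.
Let N := Dk^T *m L + Bk^T *m P12^T.

Let P12tu : P12^T \in unitmx. Proof. by rewrite unitmx_tr. Qed.

Let zetaE i : zeta i = P12^T *m e i.
Proof. by rewrite /e /T mulKVmx. Qed.

Let xiE i : xi i = e i - S *m eta i.
Proof. by rewrite /e /zeta /S mulmxDr mulKmx // mulmxA addrK. Qed.

Let ppE i : pp i = P11 *m e i + (P12 - P11 *m S) *m eta i.
Proof. by rewrite /pp xiE; mxexpand. Qed.

Let cov_ey : cov e y = 0.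
Proof. by rewrite /e cov_mull cov_zy mulmx0. Qed.

Let cov_eeta : cov e eta = 0.
Proof. by rewrite /e cov_mull cov_zeta mulmx0. Qed.

(** The rest of a is a combination of y and eta, to which both a and e are
    orthogonal; so it is orthogonal to itself. *)
Let aE i : a i = L *m e i.
Proof.
pose N1 := B^T *m (P12 - P11 *m S) + g^-1 *: (R'^T *m R' *m Ck).
pose N2 := g^-1 *: (R'^T *m R' *m Dk).
have hE k : a k - L *m e k = N1 *m eta k + N2 *m y k.
  have -> : a k = B^T *m pp k + g^-1 *: (R'^T *m (R' *m u k)).
    by rewrite -z2E -scalemxAr scalerA mulVf // scale1r.
  by rewrite ppE /u /N1 /N2 /L; mxexpand.
have h0 : cov (fun k => a k - L *m e k) (fun k => a k - L *m e k) = 0.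
  rewrite [X in cov _ X](_ : _ = fun k => N1 *m eta k + N2 *m y k); last first.
    by apply/funext => k.
  rewrite covDr (cov_mulr N1) (cov_mulr N2).
  have hz b (Y : I -> 'M[R]_(b, 2)) : cov a Y = 0 -> cov e Y = 0 ->
      cov (fun k => a k - L *m e k) Y = 0.
    move=> ha he; rewrite (eq_cov (X' := fun k => a k + - L *m e k) (Y' := Y)) //.
      by rewrite covDl cov_mull ha he mulmx0 addr0.
    by move=> k; rewrite mulNmx.
  by rewrite !hz // !mul0mx addr0.
by apply/eqP; rewrite -subr_eq0; apply/eqP; exact: (cov_eq0 h0).
Qed.

Let dualE i : Dk^T *m a i + Bk^T *m zeta i = N *m e i.
Proof. by rewrite aE zetaE /N mulmxDl !mulmxA. Qed.

Let w2e i : w2 i = g^-1 *: (V'^T *m (N *m e i)).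
Proof. by rewrite -dualE -w2E scalerA mulVf // scale1r. Qed.

Let w1e i : w1 i = g^-1 *: (W'^T *m pp i).
Proof. by rewrite -w1E scalerA mulVf // scale1r. Qed.

(** The disturbance of the sensor being a function of e, the measurement is
    Ct e - C S eta; since e is orthogonal to y and eta, Ct e is orthogonal to
    itself. *)
Let yE i : y i = - (C *m S *m eta i).
Proof.
pose Ct := C + g^-1 *: (V' *m V'^T *m N).
have hE k : y k = Ct *m e k - C *m S *m eta k.
  by rewrite /y w2e xiE /Ct; mxexpand.
have h0 : cov (fun k => Ct *m e k) (fun k => Ct *m e k) = 0.
  rewrite [X in cov _ X](_ : _ = fun k => y k + C *m S *m eta k).
    by rewrite covDr (cov_mulr (C *m S)) !(cov_mull Ct e) cov_ey cov_eeta !mulmx0 mul0mx addr0.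
  by apply/funext => k; rewrite hE subrK.
by rewrite hE (cov_eq0 h0) sub0r.
Qed.

(** At an infinite frequency e and p vanish, and the disturbance of an active
    test is a function of these: such tests carry no weight. *)
Lemma dist_infinite i : c i = 0 -> w1 i = 0 /\ w2 i = 0.
Proof.
move=> /x_inf [x0 eta0].
have e0 : e i = 0 by rewrite /e /zeta x0 eta0 !mulmx0 addr0 mulmx0.
by rewrite w1e w2e ppE e0 eta0 !mulmx0 addr0 !mulmx0 !scaler0.
Qed.

Let w i := s i / c i.

Let c0_case i : c i = 0 ->
  [/\ xi i = 0, eta i = 0, e i = 0, y i = 0 & u i = 0].
Proof.
move=> hc; have [x0 eta0] := x_inf hc.
have y0 : y i = 0 by rewrite yE eta0 mulmx0 oppr0.
split=> //; first by rewrite /e /zeta x0 eta0 !mulmx0 addr0 mulmx0.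
by rewrite /u y0 eta0 !mulmx0 addr0.
Qed.

Let xiD i : w i *: (xi i *m Jmx R) = A *m xi i + B *m u i + W' *m w1 i.
Proof.
have [hc|hc] := eqVneq (c i) 0; last exact: xi_dyn.
have [x0 eta0 e0 y0 u0] := c0_case hc; have [-> _] := dist_infinite hc.
by rewrite x0 u0 mul0mx !mulmx0 scaler0 !addr0.
Qed.

Let etaD i : w i *: (eta i *m Jmx R) = Bk *m y i + Ak *m eta i.
Proof.
have [hc|hc] := eqVneq (c i) 0; last exact: eta_dyn.
have [x0 eta0 e0 y0 u0] := c0_case hc.
by rewrite y0 eta0 mul0mx !mulmx0 scaler0 addr0.
Qed.

Let F := A + g^-1 *: (W' *m W'^T *m P11).

(** The part driven by eta, M eta, is orthogonal to eta because the
    frequency operator is skew and the derivative of eta is a combination of y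
    and eta. Hence it is orthogonal to itself, and the error runs autonomously. *)
Let eD i : w i *: (e i *m Jmx R) = F *m e i.
Proof.
pose M := - (A *m S) + B *m (Ck - Dk *m C *m S) +
  g^-1 *: (W' *m W'^T *m (P12 - P11 *m S)) + S *m (Ak - Bk *m C *m S).
have hE k : w k *: (e k *m Jmx R) = F *m e k + M *m eta k.
  have -> : e k = xi k + S *m eta k by rewrite xiE subrK.
  rewrite mulmxDl scalerDr -mulmxA [w k *: (S *m _)]scalemxAr xiD etaD.
  rewrite {1}xiE w1e ppE /u yE /F /M -[xi k + _]/(xi k + S *m eta k) xiE subrK.
  by mxexpand.
have h0 : cov (fun k => M *m eta k) (fun k => M *m eta k) = 0.
  rewrite cov_mulr (_ : cov _ eta = 0) ?mul0mx //.
  have := cov_J w e eta; rewrite (eq_cov hE (fun=> erefl)).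
  rewrite [X in cov e X](_ : _ = fun k => Bk *m y k + Ak *m eta k); last first.
    by apply/funext => k; exact: etaD.
  rewrite covDl covDr (cov_mulr Bk) (cov_mulr Ak) (cov_mull F e) cov_ey cov_eeta.
  rewrite !mul0mx mulmx0.
  by rewrite addr0 add0r oppr0.
by rewrite hE (cov_eq0 h0) addr0.
Qed.

Section Competitor.
Variables (Dk' : 'M[R]_(m, p)) (Ck' : 'M[R]_(m, n)) (Bk' : 'M[R]_(n, p)) (Ak' : 'M[R]_n).
Variables (xi' eta' : I -> 'M[R]_(n, 2)).

Let u' i := Dk' *m (C *m xi' i + V' *m w2 i) + Ck' *m eta' i.

Hypothesis hurwitz' : hurwitzmx
  (block_mx (A + B *m Dk' *m C) (B *m Ck') (Bk' *m C) Ak').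
Hypothesis x_inf' : forall i, c i = 0 -> xi' i = 0 /\ eta' i = 0.
Hypothesis xi_dyn' : forall i, c i != 0 ->
  (s i / c i) *: (xi' i *m Jmx R) = A *m xi' i + B *m u' i + W' *m w1 i.
Hypothesis eta_dyn' : forall i, c i != 0 ->
  (s i / c i) *: (eta' i *m Jmx R) =
  Bk' *m (C *m xi' i + V' *m w2 i) + Ak' *m eta' i.

Let d1 i := xi' i - xi i.
Let d i := col_mx (d1 i) (eta' i).

Let u'0 i : c i = 0 -> u' i = 0.
Proof.
move=> hc; have [x0 eta0] := x_inf' hc; have [_ w20] := dist_infinite hc.
by rewrite /u' x0 eta0 w20 !(mulmx0, addr0).
Qed.

Let d1D i : w i *: (d1 i *m Jmx R) = A *m d1 i + B *m (u' i - u i).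
Proof.
rewrite /d1 mulmxBl scalerBr xiD.
have -> : w i *: (xi' i *m Jmx R) = A *m xi' i + B *m u' i + W' *m w1 i.
  have [hc|hc] := eqVneq (c i) 0; last exact: xi_dyn'.
  have [x0 eta0] := x_inf' hc; have [w10 _] := dist_infinite hc.
  by rewrite x0 u'0 // w10 mul0mx !mulmx0 scaler0 !addr0.
by mxexpand.
Qed.

Let yd i : C *m xi' i + V' *m w2 i = C *m d1 i - C *m S *m eta i.
Proof. by rewrite -yE /y /d1; mxexpand. Qed.

Let E : 'M[R]_(m, n + n) := row_mx (Dk' *m C) Ck'.
Let H := Dk *m C *m S - Ck - Dk' *m C *m S.

Let udiff i : u' i - u i = E *m d i + H *m eta i.
Proof.
rewrite /u' /u yd yE /E /d mul_row_col /H; mxexpand.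
Qed.

(** The competitor receives the same disturbances; since y and u are functions of
    eta, the difference of states is driven by eta alone. *)
Let dD i : w i *: (d i *m Jmx R) =
  block_mx (A + B *m Dk' *m C) (B *m Ck') (Bk' *m C) Ak' *m d i +
  col_mx (B *m H) (- (Bk' *m C *m S)) *m eta i.
Proof.
have etaD' : w i *: (eta' i *m Jmx R) =
    Bk' *m (C *m xi' i + V' *m w2 i) + Ak' *m eta' i.
  have [hc|hc] := eqVneq (c i) 0; last exact: eta_dyn'.
  have [x0 eta0] := x_inf' hc; have [_ w20] := dist_infinite hc.
  by rewrite x0 eta0 w20 mul0mx scaler0 !(mulmx0, addr0).
have -> : w i *: (d i *m Jmx R) =
    col_mx (w i *: (d1 i *m Jmx R)) (w i *: (eta' i *m Jmx R)).
  by rewrite /d mul_col_mx scale_col_mx.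
rewrite d1D etaD' /d mul_block_col mul_col_mx.
rewrite add_col_mx; congr col_mx.
  by rewrite udiff /E /d mul_row_col; mxexpand.
by rewrite yd; mxexpand.
Qed.

(** The covariance M of e and d satisfies F M = - M A^T, with A the stable
    closed-loop matrix of the competitor. *)
Let cov_ed : cov e d = 0.
Proof.
apply: (sylvester_cov_eq0 hurwitz' eD).
have := cov_J w e d; rewrite (eq_cov eD (fun=> erefl)) (cov_mull F e) => ->.
rewrite [X in cov e X](_ : _ = fun i =>
  block_mx (A + B *m Dk' *m C) (B *m Ck') (Bk' *m C) Ak' *m d i +
  col_mx (B *m H) (- (Bk' *m C *m S)) *m eta i); last first.
  by apply/funext => i; exact: dD.
by rewrite covDr !cov_mulr cov_eeta mul0mx addr0.
Qed.

(** By the adjoint equation the change of the pairing with z is the pairing of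
    a = L e with the change of input, up to a pairing of e with d; both inputs
    are functions of d and eta, to which e is orthogonal. *)
Lemma pairing_invariant :
  \sum_i (fro (z1 i) (Q' *m d1 i) + fro (z2 i) (R' *m (u' i - u i))) = 0.
Proof.
have hE i : fro (z1 i) (Q' *m d1 i) + fro (z2 i) (R' *m (u' i - u i)) =
    fro (e i) (L^T *m (u' i - u i)) - fro (e i) (N^T *m (C *m d1 i)).
  have [hc|hc] := eqVneq (c i) 0.
    have [x0 eta0 e0 y0 u0] := c0_case hc; have [x'0 _] := x_inf' hc.
    by rewrite /d1 x0 x'0 u'0 // u0 e0 !(subrr, mulmx0, fro0l, fro0r, addr0).
  have -> : fro (z1 i) (Q' *m d1 i) = fro (pp i) (B *m (u' i - u i)) -
      fro (e i) (N^T *m (C *m d1 i)).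
    rewrite fro_mulmxr z1E // dualE froNl froDl froDl froZl fro_J.
    rewrite fro_mulmxl trmxK fro_mulmxl trmxK fro_mulmxl.
    rewrite mulrN -froZr d1D froDr; ring.
  rewrite fro_mulmxr -[fro (e i) (L^T *m _)]fro_mulmxl -aE /a froDl.
  by rewrite [fro (z2 i) _]fro_mulmxr; ring.
under eq_bigr do rewrite hE.
rewrite sumrB !sum_fro_cov.
have -> : cov e (fun i => L^T *m (u' i - u i)) = 0.
  rewrite cov_mulr [X in cov e X](_ : _ = fun i => E *m d i + H *m eta i).
    by rewrite covDr !cov_mulr cov_ed cov_eeta !mul0mx addr0 mul0mx.
  by apply/funext => i; exact: udiff.
have -> : cov e (fun i => N^T *m (C *m d1 i)) = 0.
  rewrite [X in cov e X](_ : _ = fun i => (N^T *m C *m row_mx 1%:M 0) *m d i).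
    by rewrite cov_mulr cov_ed mul0mx.
  by apply/funext => i; rewrite -mulmxA /d mul_row_col mul1mx mul0mx addr0 mulmxA.
by rewrite mxtrace0 subr0.
Qed.

End Competitor.

End Certificate.

(** * Block form of the closed loop *)

Section Blocks.
Variables (R : realType) (n m p : nat) (G : plant R n m p).
Variable K : 'M[R]_(m + n, p + n).
Let A := pA G.
Let B := pB G.
Let C := pC G.
Let Q' := sqrtmx (pQ G).
Let W' := sqrtmx (pW G).
Let R' := sqrtmx (pR G).
Let V' := sqrtmx (pV G).
Variables (xi eta w1 : 'M[R]_(n, 2)) (w2 : 'M[R]_(p, 2)).
Variables (pp zeta z1 : 'M[R]_(n, 2)) (z2 : 'M[R]_(m, 2)).
Let y := C *m xi + V' *m w2.
Let u := DK K *m y + CK K *m eta.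
Let a := B^T *m pp + R'^T *m z2.

(** The blocks of the closed-loop equations in terms of the measurement y, the
    input u and the dual signal a at the actuator. *)
Lemma dynamics_block : Acl G K *m col_mx xi eta + Bcl G K *m col_mx w1 w2 =
  col_mx (A *m xi + B *m u + W' *m w1) (BK K *m y + AK K *m eta).
Proof.
rewrite !mul_block_col add_col_mx mul0mx add0r.
by congr col_mx; rewrite /u /y; mxexpand.
Qed.

Lemma output_block : Ccl G K *m col_mx xi eta + Dcl G K *m col_mx w1 w2 =
  col_mx (Q' *m xi) (R' *m u).
Proof.
rewrite !mul_block_col add_col_mx !mul0mx !addr0 add0r.
by congr col_mx; rewrite /u /y; mxexpand.
Qed.

Lemma disturbance_block :
  (Bcl G K)^T *m col_mx pp zeta + (Dcl G K)^T *m col_mx z1 z2 =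
  col_mx (W'^T *m pp) (V'^T *m ((DK K)^T *m a + (BK K)^T *m zeta)).
Proof.
rewrite !tr_block_mx !mul_block_col add_col_mx !trmx_mul !trmx0.
rewrite !mul0mx !addr0 add0r.
by congr col_mx; rewrite /a; mxexpand.
Qed.

Lemma costate_block :
  usubmx ((Acl G K)^T *m col_mx pp zeta + (Ccl G K)^T *m col_mx z1 z2) =
  A^T *m pp + C^T *m ((DK K)^T *m a + (BK K)^T *m zeta) + Q'^T *m z1.
Proof.
rewrite !tr_block_mx !mul_block_col add_col_mx col_mxKu.
by rewrite !linearD /= !trmx_mul /a; mxexpand.
Qed.

Lemma senseL_block : (inB G)^T *m col_mx pp zeta + (perfD G)^T *m col_mx z1 z2 =
  col_mx a zeta.
Proof.
rewrite !tr_block_mx !mul_block_col add_col_mx !trmx0 trmx1.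
by rewrite !mul0mx mul1mx !addr0 !add0r.
Qed.

Lemma senseR_block : outC G *m col_mx xi eta + distD G *m col_mx w1 w2 =
  col_mx y eta.
Proof.
by rewrite !mul_block_col add_col_mx !mul0mx mul1mx !addr0 !add0r.
Qed.

End Blocks.

Lemma sym_block_mul (R : realType) n (P : 'M[R]_(n + n)) (xi eta : 'M[R]_(n, 2)) :
  P^T = P -> P *m col_mx xi eta = col_mx
    (ulsubmx P *m xi + ursubmx P *m eta)
    ((ursubmx P)^T *m xi + drsubmx P *m eta).
Proof.
by move=> PT; rewrite -{1}(submxK P) mul_block_col -[X in dlsubmx X]PT
  -trmx_ursub.
Qed.

(** * Global optimality *)

Section ClosedLoopPairing.
Variables (R : realType) (n m p : nat) (G : plant R n m p) (I : finType).
Variables (K K' : 'M[R]_(m + n, p + n)) (P : 'M[R]_(n + n)) (g : R).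
Variables (c s : I -> R) (x x' : I -> 'M[R]_(n + n, 2)).
Variables (w : I -> 'M[R]_(n + p, 2)) (z : I -> 'M[R]_(n + m, 2)).
Hypotheses (PT : P^T = P) (P12u : ursubmx P \in unitmx) (g_neq0 : g != 0).
Hypothesis cs : forall i, c i ^+ 2 + s i ^+ 2 = 1.
Hypothesis hx : forall i,
  s i *: (x i *m Jmx R) = c i *: (Acl G K *m x i + Bcl G K *m w i).
Hypothesis hx' : forall i,
  s i *: (x' i *m Jmx R) = c i *: (Acl G K' *m x' i + Bcl G K' *m w i).
Hypothesis k1 : forall i, (Acl G K)^T *m (P *m x i) +
  P *m (Acl G K *m x i + Bcl G K *m w i) + (Ccl G K)^T *m z i = 0.
Hypothesis k2 : forall i,
  (Bcl G K)^T *m (P *m x i) + (Dcl G K)^T *m z i = g *: w i.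
Hypothesis k3 : forall i, Ccl G K *m x i + Dcl G K *m w i = g *: z i.
Hypothesis stat : cov (fun i => (inB G)^T *m (P *m x i) + (perfD G)^T *m z i)
  (fun i => outC G *m x i + distD G *m w i) = 0.
Hypothesis hurw : hurwitzmx (Acl G K').

(** The covariance statements in block form: stationarity splits into the
    orthogonality of a and zeta to y and eta. *)
Lemma closed_loop_pairing : (forall i, c i = 0 -> w i = 0) /\
  \sum_i fro (z i) (Ccl G K' *m x' i + Dcl G K' *m w i) =
  \sum_i fro (z i) (Ccl G K *m x i + Dcl G K *m w i).
Proof.
pose xi i := usubmx (x i); pose eta i := dsubmx (x i).
pose w1 i := usubmx (w i); pose w2 i := dsubmx (w i).
pose z1 i := usubmx (z i); pose z2 i := dsubmx (z i).
pose xi' i := usubmx (x' i); pose eta' i := dsubmx (x' i).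
have xE i : x i = col_mx (xi i) (eta i) by rewrite vsubmxK.
have wE i : w i = col_mx (w1 i) (w2 i) by rewrite vsubmxK.
have zE i : z i = col_mx (z1 i) (z2 i) by rewrite vsubmxK.
have x'E i : x' i = col_mx (xi' i) (eta' i) by rewrite vsubmxK.
pose A := pA G; pose B := pB G; pose C := pC G.
pose Q' := sqrtmx (pQ G); pose W' := sqrtmx (pW G).
pose R' := sqrtmx (pR G); pose V' := sqrtmx (pV G).
pose y i := C *m xi i + V' *m w2 i.
pose u i := DK K *m y i + CK K *m eta i.
pose pp i := ulsubmx P *m xi i + ursubmx P *m eta i.
pose zeta i := (ursubmx P)^T *m xi i + drsubmx P *m eta i.
pose a i := B^T *m pp i + R'^T *m z2 i.
pose u' i := DK K' *m (C *m xi' i + V' *m w2 i) + CK K' *m eta' i.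
have PxE i : P *m x i = col_mx (pp i) (zeta i) by rewrite xE sym_block_mul.
have x_inf i : c i = 0 -> xi i = 0 /\ eta i = 0.
  by move=> ci; rewrite /xi /eta (infinite_freq_eq0 (cs i) (hx i) ci) !linear0.
have x_inf' i : c i = 0 -> xi' i = 0 /\ eta' i = 0.
  by move=> ci; rewrite /xi' /eta' (infinite_freq_eq0 (cs i) (hx' i) ci) !linear0.
have dyn i : c i != 0 -> (s i / c i) *: (xi i *m Jmx R) =
    A *m xi i + B *m u i + W' *m w1 i /\
    (s i / c i) *: (eta i *m Jmx R) = BK K *m y i + AK K *m eta i.
  move=> ci; have := finite_freq ci (hx i).
  rewrite wE {1}xE xE dynamics_block mul_col_mx scale_col_mx.
  by move/eq_col_mx.
have dyn' i : c i != 0 -> (s i / c i) *: (xi' i *m Jmx R) =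
    A *m xi' i + B *m u' i + W' *m w1 i /\
    (s i / c i) *: (eta' i *m Jmx R) =
    BK K' *m (C *m xi' i + V' *m w2 i) + AK K' *m eta' i.
  move=> ci; have := finite_freq ci (hx' i).
  rewrite wE {1}x'E x'E dynamics_block mul_col_mx scale_col_mx.
  by move/eq_col_mx.
have w12 i : g *: w1 i = W'^T *m pp i /\
    g *: w2 i = V'^T *m ((DK K)^T *m a i + (BK K)^T *m zeta i).
  have := k2 i; rewrite PxE zE wE disturbance_block scale_col_mx.
  by move/eq_col_mx => [-> ->].
have z2E i : g *: z2 i = R' *m u i.
  have := k3 i; rewrite xE zE wE output_block scale_col_mx.
  by move/eq_col_mx => [_ ->].
have z1E i : c i != 0 -> Q'^T *m z1 i =
    - (A^T *m pp i + (s i / c i) *: (pp i *m Jmx R) +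
       C^T *m ((DK K)^T *m a i + (BK K)^T *m zeta i)).
  move=> ci; have := k1 i; rewrite -(finite_freq ci (hx i)).
  rewrite -scalemxAr (mulmxA P) addrAC PxE zE => /(congr1 usubmx).
  rewrite linearD /= costate_block mul_col_mx scale_col_mx col_mxKu linear0.
  by move=> h; apply/eqP; rewrite -addr_eq0 -h; apply/eqP; mxlin.
have stat4 : [/\ cov a y = 0, cov a eta = 0, cov zeta y = 0 & cov zeta eta = 0].
  have LE i : (inB G)^T *m (P *m x i) + (perfD G)^T *m z i =
      col_mx (a i) (zeta i) by rewrite PxE zE senseL_block.
  have YE i : outC G *m x i + distD G *m w i = col_mx (y i) (eta i).
    by rewrite xE wE senseR_block.
  have := stat; rewrite (eq_cov LE YE) => h.
  split.
  - by rewrite -(cov_ul a zeta y eta) h /ulsubmx !linear0.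
  - by rewrite -(cov_ur a zeta y eta) h /ursubmx !linear0.
  - by rewrite -(cov_dl a zeta y eta) h /dlsubmx !linear0.
  - by rewrite -(cov_dr a zeta y eta) h /drsubmx !linear0.
have [s1 s2 s3 s4] := stat4.
split.
  move=> i ci; rewrite wE.
  have [-> ->] := dist_infinite g_neq0 P12u x_inf (fun i => proj1 (w12 i))
    (fun i => proj2 (w12 i)) z2E s1 s2 s3 s4 ci.
  by rewrite col_mx0.
have := pairing_invariant g_neq0 P12u x_inf (fun i ci => proj1 (dyn i ci))
  (fun i ci => proj2 (dyn i ci)) (fun i => proj1 (w12 i))
  (fun i => proj2 (w12 i)) z2E z1E s1 s2 s3 s4 hurw x_inf'
  (fun i ci => proj1 (dyn' i ci)) (fun i ci => proj2 (dyn' i ci)).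
move=> h; apply/eqP; rewrite -subr_eq0 -sumrB -[X in _ == X]h; apply/eqP.
apply: eq_bigr => i _; rewrite -froBr x'E xE wE !output_block zE.
by rewrite opp_col_mx add_col_mx fro_col !mulmxBr.
Qed.

End ClosedLoopPairing.

Section Optimality.
Variables (R : realType) (n m p : nat) (G : plant R n m p).
Hypothesis np_gt0 : (0 < n + p)%N.
Variable K : 'M[R]_(m + n, p + n).
Let g := Hinf_cost G K.

(** A vanishing convex combination of the gradients at active tests. *)
Definition certificate (d : nat) (us : 'I_d -> test R n m p) (l : 'I_d -> R) :=
  [/\ forall i, tests (us i) /\ g <= gain G K (us i),
      forall i, 0 <= l i, \sum_i l i = 1 &
      \sum_i l i *: (senseL G K (us i) *m (senseR G K (us i))^T) = 0].

Lemma clarke_certificate : regular G K -> clarke_subdiff (Hinf_cost G) K 0 ->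
  exists (d : nat) us l, @certificate d us l.
Proof.
move=> hK hstat.
pose S := @tests R n m p `&` [set u | g <= gain G K u].
pose gr u := mxvec (senseL G K u *m (senseR G K u)^T).
have cS : compact S.
  apply: compact_setI_closed_in; first exact: compact_tests.
  move=> u hu /negP; rewrite -ltNge => hlt.
  have : \forall u' \near u, gain G K u' < g.
    exact: (gain_continuous hK hu (lt_nbhsl hlt)).
  by apply: filterS => u'; rewrite ltNge => /negP.
have grc u : S u -> gr @ u --> gr u.
  move=> [[cs _ _] _]; have hu := hK _ _ cs.
  have FF : Filter (nbhs u) by exact: nbhs_filter.
  have cK : (fun _ : test R n m p => K) @ u --> K by exact: cvg_cst.
  have cu : (fun x : test R n m p => x) @ u --> u by exact: cvg_id.
  have cL := @cvg_senseL R n m p G _ _ FF _ _ K u cK cu hu.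
  have cR := @cvg_senseR R n m p G _ _ FF _ _ K u cK cu hu.
  have cM : senseL G K x *m (senseR G K x)^T @[x --> u] -->
      senseL G K u *m (senseR G K u)^T.
    exact: (@cvg_mulmx _ _ _ FF _ _ _ _ _ _ _ cL (@cvg_trmx _ _ _ FF _ _ _ _ cR)).
  apply: (iffLR (@cvg_mx _ _ _ FF _ _ _ _)) => i j.
  case/mxvec_indexP: j => j k; rewrite (ord1 i) mxvecE.
  under eq_fun do rewrite mxvecE.
  exact: (iffRL (@cvg_mx _ _ _ FF _ _ _ _) cM j k).
have hv v : exists u, S u /\ 0 <= rdot (gr u) v.
  have [u [hu hg hs]] := clarke_active np_gt0 (vec_mx v) hK hstat.
  exists u; split; first by split.
  by rewrite -(vec_mxK v) rdot_mxvec fro_outer.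
have [us [l [hS [l0 l1] hsum]]] := gordan cS grc hv.
exists _, us, l; split=> //.
apply: (can_inj mxvecK); rewrite linear_sum linear0 -[RHS]hsum.
by apply: eq_bigr => i _; rewrite linearZ.
Qed.

(** Absorb the square root of each weight into its test. The pairing with z of
    the responses to the w_i is g for K, hence also for the competitor, whose
    cost bounds it. *)
Lemma certificate_optimal (P : 'M[R]_(n + n)) d us l K' :
  pdmx P -> ursubmx P \in unitmx -> nsdmx (brl_mx G g K P) -> 0 < g ->
  regular G K -> @certificate d us l -> stabilizing G K' ->
  g <= Hinf_cost G K'.
Proof.
move=> hP P12u hL g0 hK [hus l0 l1 hsum] hK'.
have PT := psdmx_sym (proj1 hP).
have gn0 : g != 0 by rewrite gt_eqF.
have rK' := stabilizing_regular hK'.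
pose r i := Num.sqrt (l i).
have rr i : r i * r i = l i by rewrite -expr2 sqr_sqrtr.
pose c i := (us i).1.1; pose s i := (us i).1.2.
pose w i := r i *: (us i).2.1; pose z i := r i *: (us i).2.2.
pose x i := state G K (c i) (s i) (w i).
pose x' i := state G K' (c i) (s i) (w i).
have cs i : c i ^+ 2 + s i ^+ 2 = 1 by have [[]] := hus i.
have hx i : s i *: (x i *m Jmx R) = c i *: (Acl G K *m x i + Bcl G K *m w i).
  exact: stateP (hK _ _ (cs i)).
have hx' i : s i *: (x' i *m Jmx R) = c i *: (Acl G K' *m x' i + Bcl G K' *m w i).
  exact: stateP (rK' _ _ (cs i)).
have xr i : x i = r i *: state G K (c i) (s i) (us i).2.1 by exact: stateZ.
have ker i : [/\ (Acl G K)^T *m (P *m x i) + P *m (Acl G K *m x i + Bcl G K *m w i)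
        + (Ccl G K)^T *m z i = 0,
      (Bcl G K)^T *m (P *m x i) + (Dcl G K)^T *m z i = g *: w i &
      Ccl G K *m x i + Dcl G K *m w i = g *: z i].
  have [hu hg] := hus i.
  have [k1 k2 k3 _ _] := brl_kernel hP hL g0 (hK _ _ (cs i)) hu hg.
  move: k1 k2 k3; rewrite xr /z /w -/(c i) -/(s i).
  move: (state G K _ _ _) => y k1 k2 k3; split.
  - by rewrite -!scalemxAr -scalerDr -!scalemxAr -!scalerDr k1 scaler0.
  - by rewrite -!scalemxAr -scalerDr k2 !scalerA mulrC.
  - by rewrite -!scalemxAr -scalerDr k3 !scalerA mulrC.
have norm1 i : fro (us i).2.1 (us i).2.1 = 1 /\ fro (us i).2.2 (us i).2.2 = 1.
  have [hu hg] := hus i.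
  by have [_ _ _ n1 n2] := brl_kernel hP hL g0 (hK _ _ (cs i)) hu hg.
have covLY : cov (fun i => (inB G)^T *m (P *m x i) + (perfD G)^T *m z i)
  (fun i => outC G *m x i + distD G *m w i) = 0.
  rewrite -[RHS]hsum; apply: eq_bigr => i _.
  have [hu hg] := hus i.
  rewrite (senseL_active hP hL g0 (hK _ _ (cs i)) hu hg) /senseR.
  rewrite xr /z /w -/(c i) -/(s i).
  move: (state G K _ _ _) => y.
  rewrite -!scalemxAr -!scalerDr linearZ /= -scalemxAl -scalemxAr scalerA rr.
  by [].
have [winf hpair] := closed_loop_pairing PT P12u gn0 cs hx hx'
  (fun i => let: And3 h _ _ := ker i in h) (fun i => let: And3 _ h _ := ker i in h)
  (fun i => let: And3 _ _ h := ker i in h) covLY hK'.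
have ww i : fro (w i) (w i) = l i.
  by rewrite froZl froZr (proj1 (norm1 i)) mulr1 rr.
have zz i : fro (z i) (z i) = l i.
  by rewrite froZl froZr (proj2 (norm1 i)) mulr1 rr.
have lhs : \sum_i fro (z i) (Ccl G K *m x i + Dcl G K *m w i) = g.
  rewrite -[RHS]mulr1 -l1 mulr_sumr; apply: eq_bigr => i _.
  by have [_ _ ->] := ker i; rewrite froZr zz.
rewrite -lhs -hpair -[leRHS]mulr1 -l1 mulr_sumr; apply: ler_sum => i _.
have hgain : fro (z i) (Ccl G K' *m x' i + Dcl G K' *m w i) =
    l i * gain G K' (us i).
  have -> : Ccl G K' *m x' i + Dcl G K' *m w i =
      r i *: resp G K' (c i) (s i) (us i).2.1 by exact: respZ.
  by rewrite froZl froZr mulrA rr.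
rewrite hgain mulrC; have [ci|ci] := eqVneq (c i) 0.
  have li : l i = 0 by rewrite -ww winf // fro0l.
  by rewrite li !mulr0.
exact: (ler_wpM2r (l0 i) (gain_le_Hinf np_gt0 rK' (proj1 (hus i)) ci)).
Qed.

End Optimality.

Theorem theorem5p2 (R : realType) (n m p : nat) (G : plant R n m p)
  (hn : (0 < n)%N) (hm : (0 < m)%N) (hp : (0 < p)%N)
  (hQ : psdmx (pQ G)) (hW : psdmx (pW G))
  (hR : pdmx (pR G)) (hV : pdmx (pV G))
  (hAB : controllable (pA G) (pB G))
  (hAW : controllable (pA G) (sqrtmx (pW G)))
  (hCA : observable (pC G) (pA G))
  (hQA : observable (sqrtmx (pQ G)) (pA G))
  (K : 'M[R]_(m + n, p + n))
  (hK : nondegenerate_policy G K)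
  (hstat : clarke_subdiff (Hinf_cost G) K 0) :
  stabilizing G K /\
  forall K' : 'M[R]_(m + n, p + n),
    stabilizing G K' -> Hinf_cost G K <= Hinf_cost G K'.
Proof.
case: hK => stabK [P [hP P12u hL]]; split; first exact: stabK.
move=> K' stabK'.
have np_gt0 : (0 < n + p)%N by rewrite addn_gt0 hn.
have regK := stabilizing_regular stabK.
have := Hinf_ge0 G K; rewrite le_eqVlt => /orP[/eqP <-|g0].
  exact: Hinf_ge0.
have [d [us [l cert]]] := clarke_certificate np_gt0 regK hstat.
exact: (certificate_optimal np_gt0 hP P12u hL g0 regK cert stabK').
Qed.
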